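(* For all real $q>\frac{1}{2}$, $$\int_{0}^{1}\frac{\left(x^{2q-2}+1\right)\log\left(x^q+1\right)}{x^{2q}+1}\,dx=\frac{1}{16q}\left[\psi'\left(\frac{4q-1}{4q}\right)-\psi'\left(\frac{2q-1}{4q}\right)\right]-\frac{1}{q}\sum_{n=0}^{\infty}\frac{2^n\,\Gamma\left(n+2-\frac{1}{q}\right)\Gamma\left(n+\frac{1}{q}\right)}{(2n+1)!}\left[\psi\left(n+2-\frac{1}{q}\right)-\psi(2n+2)\right].$$
   Context: $\Gamma$ is the gamma function, $\psi=\Gamma'/\Gamma$ is the digamma function, and $\psi'$ is its derivative. *)

(* Defs.v *)
From HB Require Import structures.
From mathcomp Require Import all_boot all_order all_algebra.
From mathcomp Require Import all_classical all_reals all_analysis.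

Set Implicit Arguments.
Unset Strict Implicit.
Unset Printing Implicit Defensive.
Import Order.TTheory GRing.Theory Num.Theory.
Import numFieldNormedType.Exports.
Local Open Scope classical_set_scope.
Local Open Scope ring_scope.

(* Euler's integral, the value of the gamma function for 0 < x.  For x <= 0
   the integral diverges and [Rintegral] returns the junk value 0, so
   [gamma], [digamma] and [trigamma] are meaningful for 0 < x only. *)
Definition gamma (R : realType) (x : R) : R :=
  \int[@lebesgue_measure R]_(t in `]0, +oo[) (t `^ (x - 1) * expR (- t)).

Definition digamma (R : realType) (x : R) : R := derive1 (@gamma R) x / gamma x.

Definition trigamma (R : realType) (x : R) : R := derive1 (@digamma R) x.

(* Main.v *)
(* With a = 1/q, the substitutions x = t^a on ]0, 1] and x = t^(-a) on
   [1, +oo[ give LHS = a (K - L), where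
     K = int_0^oo t^(a-1) ln (1+t) / (1+t^2) dt,
     L = int_1^oo t^(a-1) ln t / (1+t^2) dt.
   Since 1 + t^2 = (1+t)^2 - 2t, expanding 1/(1+t^2) as the geometric series
   of 2^n t^n / (1+t)^(2n+2) turns K into a series of nonnegative terms
     int_0^oo t^(x-1) ln (1+t) (1+t)^(-(x+y)) dt
       = B(x, y) (digamma (x+y) - digamma y),
   minus the derivative of Euler's beta integral
   B(x, y) = gamma x gamma y / gamma (x+y) in x + y, with x fixed. Expanding in powers of 1/t gives
     L = sum_j (4j+2-a)^-2 - (4j+4-a)^-2,
   a difference of trigamma values.

   The series trigamma x = sum_k (x+k)^-2 needs no product formula for gamma:
   the previous integral is nonnegative, so digamma is nondecreasing, and
   together with digamma (x+1) = digamma x + 1/x this forces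
     digamma y - digamma x = sum_k 1/(x+k) - 1/(y+k). *)

Require Import Defs.
From HB Require Import structures.
From mathcomp Require Import all_boot all_order all_algebra.
From mathcomp Require Import all_classical all_reals all_analysis.
From mathcomp Require Import measurable_realfun zify ring lra.

Set Implicit Arguments.
Unset Strict Implicit.
Unset Printing Implicit Defensive.
Import Order.TTheory GRing.Theory Num.Theory.
Import numFieldNormedType.Exports.
Local Open Scope classical_set_scope.
Local Open Scope ring_scope.

(** * Change of variables for nonnegative integrands *)

Section substitution.
Context {R : realType}.
Implicit Types (F f G H : R -> R) (a b : nat -> R) (A B : set R).
Let mu := @lebesgue_measure R.

(** Packages the side conditions of the library's substitution theorems on [[a, b]]. They hold
    because [F] is differentiable with continuous derivative at every point of [A], endpoints
    included, so the one-sided limits are plain continuity. *)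
Lemma derive1_itv_regular F f (a b : R) (A : set R) : a < b ->
  `[a, b] `<=` A ->
  (forall x, A x -> is_derive x 1 F (f x)) ->
  (forall x, A x -> {for x, continuous f}) ->
  [/\ {in `]a, b[, continuous (derive1 F)}, derive1 F x @[x --> a^'+] --> f a,
      derive1 F x @[x --> b^'-] --> f b, derivable_oo_LRcontinuous F a b &
      {in `]a, b[, derive1 F =1 f}].
Proof.
move=> ab abA dF cf.
have F'f x : A x -> derive1 F x = f x.
  by move=> Ax; rewrite derive1E; apply: derive_val; exact: dF.
have ooA x : x \in `]a, b[ -> A x.
  by move=> xab; apply: abA => /=; exact: subset_itv_oo_cc.
have Aa : A a by apply: abA; rewrite /= in_itv/= lexx ltW.
have Ab : A b by apply: abA; rewrite /= in_itv/= lexx ltW.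
have cF x : A x -> F y @[y --> x] --> F x.
  move=> Ax; apply/differentiable_continuous/derivable1_diffP.
  by have := dF _ Ax => -[].
split.
- move=> x xab; rewrite /continuous_at F'f; last exact: ooA.
  have := cf x (ooA _ xab); apply: cvg_trans; apply: near_eq_cvg.
  by near=> y; rewrite F'f//; apply: ooA; near: y; exact: near_in_itvoo.
- have /cvg_at_right_filter := cf _ Aa; apply: cvg_trans; apply: near_eq_cvg.
  near=> y; rewrite F'f//; apply: ooA; rewrite in_itv/=; apply/andP; split => //.
- have /cvg_at_left_filter := cf _ Ab; apply: cvg_trans; apply: near_eq_cvg.
  near=> y; rewrite F'f//; apply: ooA; rewrite in_itv/=; apply/andP; split => //.
- split.
  + by move=> x /ooA Ax; have := dF _ Ax => -[].
  + exact/cvg_at_right_filter/cF.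
  + exact/cvg_at_left_filter/cF.
- by move=> x /ooA /F'f.
Unshelve. all: end_near. Qed.

(** Monotone convergence on both sides: nonnegative integrals over increasing sets converge to the
    integral over the union, finite or not. *)
Lemma ge0_integral_exhaust (A B : (set R)^nat) G H :
  (forall n, measurable (A n)) -> (forall n, measurable (B n)) ->
  {homo A : m n / (m <= n)%N >-> m `<=` n} ->
  {homo B : m n / (m <= n)%N >-> m `<=` n} ->
  (forall x, (\bigcup_n A n) x -> {for x, continuous H}) ->
  (forall x, (\bigcup_n B n) x -> {for x, continuous G}) ->
  (forall x, (\bigcup_n A n) x -> 0 <= H x) ->
  (forall x, (\bigcup_n B n) x -> 0 <= G x) ->
  (forall n, \int[mu]_(x in B n) (G x)%:E = \int[mu]_(x in A n) (H x)%:E)%E ->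
  (\int[mu]_(x in \bigcup_n B n) (G x)%:E =
   \int[mu]_(x in \bigcup_n A n) (H x)%:E)%E.
Proof.
move=> mA mB ndA ndB cH cG H0 G0 AB.
have mcont (C : set R) (K : R -> R) : measurable C ->
    (forall x, C x -> {for x, continuous K}) ->
    measurable_fun C K.
  move=> mC cK; apply: subspace_continuous_measurable_fun => //.
  by apply: continuous_in_subspaceT => x /set_mem; exact: cK.
have lA : (\int[mu]_(x in A n) (H x)%:E)%E @[n --> \oo] -->
    (\int[mu]_(x in \bigcup_n A n) (H x)%:E)%E.
  apply: ge0_nondecreasing_set_cvg_integral => //.
  - by move=> m n /ndA mn; exact/subsetPset.
  - by move=> n; apply/measurable_EFinP; apply: mcont => // x Ax; apply: cH; exists n.
  - by move=> n x Ax; rewrite lee_fin; apply: H0; exists n.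
have lB : (\int[mu]_(x in B n) (G x)%:E)%E @[n --> \oo] -->
    (\int[mu]_(x in \bigcup_n B n) (G x)%:E)%E.
  apply: ge0_nondecreasing_set_cvg_integral => //.
  - by move=> m n /ndB mn; exact/subsetPset.
  - by move=> n; apply/measurable_EFinP; apply: mcont => // x Bx; apply: cG; exists n.
  - by move=> n x Bx; rewrite lee_fin; apply: G0; exists n.
move/cvg_lim : lA => <- //; move/cvg_lim : lB => <- //.
by congr (limn _); apply/funext => n; exact: AB.
Qed.

(** The compact substitution theorem is applied on each [[a n, b n]], and these intervals exhaust
    [A] while their images exhaust [B]. Nonnegativity of the integrands replaces any integrability
    assumption in the limit. *)
Lemma ge0_integral_subst_increasing F f G a b A B :
  (forall n, a n < b n) ->
  {homo a : m n / (m <= n)%N >-> n <= m} ->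
  {homo b : m n / (m <= n)%N >-> m <= n} ->
  \bigcup_n `[a n, b n]%classic = A -> \bigcup_n `[F (a n), F (b n)]%classic = B ->
  (forall x y, A x -> A y -> x < y -> F x < F y) ->
  (forall x, A x -> is_derive x 1 F (f x)) ->
  (forall x, A x -> {for x, continuous f}) ->
  (forall x, A x -> 0 <= f x) ->
  (forall x, B x -> {for x, continuous G}) ->
  (forall x, B x -> 0 <= G x) ->
  (\int[mu]_(x in B) (G x)%:E = \int[mu]_(x in A) (G (F x) * f x)%:E)%E.
Proof.
move=> ab nda ndb Ae Be incF dF cf f0 cG G0.
have Asub n : `[a n, b n] `<=` A by rewrite -Ae => x; exists n.
have Bsub n : `[F (a n), F (b n)] `<=` B by rewrite -Be => x; exists n.
have Aa n : A (a n) by apply: (Asub n); rewrite /= in_itv/= lexx ltW.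
have Ab n : A (b n) by apply: (Asub n); rewrite /= in_itv/= lexx ltW.
have leF x y : A x -> A y -> x <= y -> F x <= F y.
  move=> Ax Ay; rewrite le_eqVlt => /predU1P[->//|xy]; apply/ltW; exact: incF.
have AB x : A x -> B (F x).
  rewrite -{1}Ae => -[n _ /= xab]; apply: (Bsub n).
  have Ax := Asub n _ xab.
  move: xab; rewrite /= !in_itv/= => /andP[ax xb].
  by rewrite !leF.
have cF x : A x -> F y @[y --> x] --> F x.
  move=> Ax; apply/differentiable_continuous/derivable1_diffP.
  by have := dF _ Ax => -[].
rewrite -[in LHS]Be -[in RHS]Ae.
apply: (@ge0_integral_exhaust (fun n => `[a n, b n]%classic)
  (fun n => `[F (a n), F (b n)]%classic) G (fun x => G (F x) * f x)) => //.
- move=> m n mn; apply: subset_itv; rewrite bnd_simp; [exact: nda|exact: ndb].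
- move=> m n mn; apply: subset_itv; rewrite bnd_simp; apply: leF => //.
    exact: nda.
  exact: ndb.
- rewrite Ae => x Ax; apply: continuousM; last exact: cf.
  by apply: continuous_comp; [exact: cF|apply: cG; exact: AB].
- by rewrite Be.
- by rewrite Ae => x Ax; rewrite mulr_ge0 ?f0// G0//; exact: AB.
- by rewrite Be.
move=> n.
have [cF' Fa Fb FLR F'f] := derive1_itv_regular (ab n) (Asub n) dF cf.
rewrite integration_by_substitution_increasing //.
(* The library theorem produces [derive1 F], identified with [f] only on the open interval; the
   endpoints are removed on both sides, being null. *)
- rewrite [LHS]integral_itv_bndoo; last first.
    apply/measurable_EFinP/measurable_funM.
      apply: subspace_continuous_measurable_fun => //.
      apply: continuous_in_subspaceT => x /set_mem xab.
      have Ax : A x by apply: (Asub n) => /=; exact: subset_itv_oo_cc.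
      by apply: continuous_comp; [exact: cF|apply: cG; exact: AB].
    apply: subspace_continuous_measurable_fun => //.
    by apply: continuous_in_subspaceT => x /set_mem; exact: cF'.
  rewrite [RHS]integral_itv_bndoo; last first.
    apply/measurable_EFinP.
    apply: subspace_continuous_measurable_fun => //.
    apply: continuous_in_subspaceT => x /set_mem xab.
    have Ax : A x by apply: (Asub n) => /=; exact: subset_itv_oo_cc.
    apply: continuousM; last exact: cf.
    by apply: continuous_comp; [exact: cF|apply: cG; exact: AB].
  by apply: eq_integral => x /set_mem xab; rewrite /GRing.mul/= F'f.
- exact: ltW.
- by move=> x y xab yab; apply: incF; exact: (Asub n).
- by apply/cvg_ex; exists (f (a n)).
- by apply/cvg_ex; exists (f (b n)).
- by apply: continuous_in_subspaceT => x /set_mem xB; apply: cG; exact: (Bsub n).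
Qed.

(** Same exhaustion; here [f] is minus the derivative, hence nonnegative, and the endpoints of the
    image intervals swap. *)
Lemma ge0_integral_subst_decreasing F f G a b A B :
  (forall n, a n < b n) ->
  {homo a : m n / (m <= n)%N >-> n <= m} ->
  {homo b : m n / (m <= n)%N >-> m <= n} ->
  \bigcup_n `[a n, b n]%classic = A -> \bigcup_n `[F (b n), F (a n)]%classic = B ->
  (forall x y, A x -> A y -> x < y -> F y < F x) ->
  (forall x, A x -> is_derive x 1 F (- f x)) ->
  (forall x, A x -> {for x, continuous f}) ->
  (forall x, A x -> 0 <= f x) ->
  (forall x, B x -> {for x, continuous G}) ->
  (forall x, B x -> 0 <= G x) ->
  (\int[mu]_(x in B) (G x)%:E = \int[mu]_(x in A) (G (F x) * f x)%:E)%E.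
Proof.
move=> ab nda ndb Ae Be decF dF cf f0 cG G0.
have Asub n : `[a n, b n] `<=` A by rewrite -Ae => x; exists n.
have Bsub n : `[F (b n), F (a n)] `<=` B by rewrite -Be => x; exists n.
have Aa n : A (a n) by apply: (Asub n); rewrite /= in_itv/= lexx ltW.
have Ab n : A (b n) by apply: (Asub n); rewrite /= in_itv/= lexx ltW.
have leF x y : A x -> A y -> x <= y -> F y <= F x.
  move=> Ax Ay; rewrite le_eqVlt => /predU1P[->//|xy]; apply/ltW; exact: decF.
have AB x : A x -> B (F x).
  rewrite -{1}Ae => -[n _ /= xab]; apply: (Bsub n).
  have Ax := Asub n _ xab.
  move: xab; rewrite /= !in_itv/= => /andP[ax xb].
  by rewrite !leF.
have cF x : A x -> F y @[y --> x] --> F x.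
  move=> Ax; apply/differentiable_continuous/derivable1_diffP.
  by have := dF _ Ax => -[].
rewrite -[in LHS]Be -[in RHS]Ae.
apply: (@ge0_integral_exhaust (fun n => `[a n, b n]%classic)
  (fun n => `[F (b n), F (a n)]%classic) G (fun x => G (F x) * f x)) => //.
- move=> m n mn; apply: subset_itv; rewrite bnd_simp; [exact: nda|exact: ndb].
- move=> m n mn; apply: subset_itv; rewrite bnd_simp; apply: leF => //.
    exact: ndb.
  exact: nda.
- rewrite Ae => x Ax; apply: continuousM; last exact: cf.
  by apply: continuous_comp; [exact: cF|apply: cG; exact: AB].
- by rewrite Be.
- by rewrite Ae => x Ax; rewrite mulr_ge0 ?f0// G0//; exact: AB.
- by rewrite Be.
move=> n.
have cNf x : A x -> {for x, continuous (fun x => - f x)}.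
  by move=> Ax; apply: continuousN; exact: cf.
have [cF' Fa Fb FLR F'f] := derive1_itv_regular (ab n) (Asub n) dF cNf.
rewrite integration_by_substitution_decreasing //.
- rewrite [LHS]integral_itv_bndoo; last first.
    apply/measurable_EFinP/measurable_funM.
      apply: subspace_continuous_measurable_fun => //.
      apply: continuous_in_subspaceT => x /set_mem xab.
      have Ax : A x by apply: (Asub n) => /=; exact: subset_itv_oo_cc.
      by apply: continuous_comp; [exact: cF|apply: cG; exact: AB].
    apply: subspace_continuous_measurable_fun => //.
    apply: continuous_in_subspaceT => x /set_mem xab; apply: continuousN.
    exact: cF'.
  rewrite [RHS]integral_itv_bndoo; last first.
    apply/measurable_EFinP.
    apply: subspace_continuous_measurable_fun => //.
    apply: continuous_in_subspaceT => x /set_mem xab.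
    have Ax : A x by apply: (Asub n) => /=; exact: subset_itv_oo_cc.
    apply: continuousM; last exact: cf.
    by apply: continuous_comp; [exact: cF|apply: cG; exact: AB].
  apply: eq_integral => x /set_mem xab.
  by rewrite /GRing.mul/= /GRing.opp/= F'f// opprK.
- exact: ltW.
- by move=> x y xab yab xy; apply: decF => //; exact: (Asub n).
- by apply/cvg_ex; exists (- f (a n)).
- by apply/cvg_ex; exists (- f (b n)).
- by apply: continuous_in_subspaceT => x /set_mem xB; apply: cG; exact: (Bsub n).
Qed.

End substitution.

(** * Scaling and power substitutions on the positive half-line *)

Section power_substitutions.
Context {R : realType}.
Implicit Types (G : R -> R) (c p : R).
Let mu := @lebesgue_measure R.

Lemma powRD_gt0 (x r s : R) : 0 < x -> x `^ (r + s) = x `^ r * x `^ s.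
Proof. by move=> x0; rewrite powRD// (gt_eqF x0) implybT. Qed.

Lemma bigcup_itvcc_0y (a b : nat -> R) :
  {homo a : m n / (m <= n)%N >-> n <= m} ->
  {homo b : m n / (m <= n)%N >-> m <= n} ->
  (forall n, 0 < a n) ->
  (forall e, 0 < e -> exists n, a n <= e) -> (forall M, exists n, M <= b n) ->
  \bigcup_n `[a n, b n]%classic = `]0, +oo[%classic.
Proof.
move=> nda ndb a0 ae bM; apply/seteqP; split=> x /=.
  by move=> [n _ /=]; rewrite !in_itv/= andbT => /andP[/(lt_le_trans (a0 n))].
rewrite in_itv/= andbT => x0.
have [i ai] := ae _ x0; have [j bj] := bM x.
exists (maxn i j) => //=; rewrite in_itv/=; apply/andP; split.
  by apply: le_trans ai; apply: nda; exact: leq_maxl.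
by apply: (le_trans bj); apply: ndb; exact: leq_maxr.
Qed.

Lemma bigcup_itvcc_01 (a : nat -> R) : (forall n, 0 < a n) ->
  (forall e, 0 < e -> exists n, a n <= e) ->
  \bigcup_n `[a n, 1]%classic = `]0, 1]%classic.
Proof.
move=> a0 ae; apply/seteqP; split=> x /=.
  by move=> [n _ /=]; rewrite !in_itv/= => /andP[/(lt_le_trans (a0 n)) ->].
rewrite in_itv/= => /andP[x0 x1]; have [n an] := ae _ x0.
by exists n => //=; rewrite in_itv/= an.
Qed.

Lemma bigcup_itvcc_1y (b : nat -> R) : (forall M, exists n, M <= b n) ->
  \bigcup_n `[1, b n]%classic = `[1, +oo[%classic.
Proof.
move=> bM; apply/seteqP; split=> x /=.
  by move=> [n _ /=]; rewrite !in_itv/= andbT => /andP[].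
rewrite in_itv/= andbT => x1; have [n bn] := bM x.
by exists n => //=; rewrite in_itv/= x1.
Qed.

(** The exhausting intervals have endpoints [n.+2] or its powers: starting at 2 keeps them strictly
    on their side of 1, so no interval is degenerate. *)
Lemma nat_ge_real (M : R) : exists n, M <= n.+2%:R.
Proof.
exists (Num.bound M); have [M0|/ltW M0] := leP 0 M; last exact: (le_trans M0).
by rewrite (le_trans (ltW (archi_boundP M0)))// ler_nat; lia.
Qed.

Lemma natV_le_real (e : R) : 0 < e -> exists n, n.+2%:R^-1 <= e.
Proof.
move=> e0; have [n en] := nat_ge_real e^-1.
by exists n; rewrite -[e]invrK lef_pV2// posrE// invr_gt0.
Qed.

Lemma powR_natN_le (p e : R) : 0 < p -> 0 < e -> exists n, n.+2%:R `^ (- p) <= e.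
Proof.
(* The threshold is the solution [N] of N^(-p) = e. *)
move=> p0 e0; have [n en] := nat_ge_real (e `^ (- p^-1)).
exists n; have -> : e = (e `^ (- p^-1)) `^ (- p).
  by rewrite -powRrM mulrNN mulVf ?gt_eqF// powRr1// ltW.
rewrite [leLHS]powRN [leRHS]powRN lef_pV2 ?posrE ?powR_gt0//.
by rewrite ge0_ler_powR ?nnegrE ?powR_ge0 ?(ltW p0).
Qed.

Lemma ge0_integral_scale G c : 0 < c ->
  (forall x, 0 < x -> {for x, continuous G}) -> (forall x, 0 < x -> 0 <= G x) ->
  (\int[mu]_(x in `]0%R, +oo[) (G x)%:E =
   \int[mu]_(x in `]0%R, +oo[) (G (c * x) * c)%:E)%E.
Proof.
move=> c0 cG G0.
have ndV m n : (m <= n)%N -> (n.+2%:R^-1 : R) <= m.+2%:R^-1.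
  by move=> mn; rewrite lef_pV2 ?posrE// ler_nat; lia.
have nd m n : (m <= n)%N -> (m.+2%:R : R) <= n.+2%:R.
  by move=> mn; rewrite ler_nat; lia.
apply: (@ge0_integral_subst_increasing R ( *%R c) (cst c) G
  (fun n => n.+2%:R^-1) (fun n => n.+2%:R)) => //=.
- by move=> n; rewrite (@lt_trans _ _ 1)// ?invf_lt1// ltr1n.
- apply: bigcup_itvcc_0y => //; [exact: natV_le_real|exact: nat_ge_real].
- apply: bigcup_itvcc_0y.
  + by move=> m n mn; rewrite ler_pM2l// ndV.
  + by move=> m n mn; rewrite ler_pM2l// nd.
  + by move=> n; rewrite mulr_gt0.
  + move=> e e0; have [n ne] := natV_le_real (divr_gt0 e0 c0).
    by exists n; rewrite mulrC -ler_pdivlMr.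
  + move=> M; have [n Mn] := nat_ge_real (M / c).
    by exists n; rewrite mulrC -ler_pdivrMr.
- by move=> x y _ _; rewrite ltr_pM2l.
- move=> x _; apply: is_derive_eq; rewrite /GRing.scale/=; ring.
- by move=> x _; exact: cst_continuous.
- by move=> x _; rewrite ltW.
- by move=> x; rewrite in_itv/= andbT; exact: cG.
- by move=> x; rewrite in_itv/= andbT; exact: G0.
Qed.

Lemma continuous_powR_at p x : 0 < x -> {for x, continuous (@powR R ^~ p)}.
Proof.
move=> x0; apply/differentiable_continuous/derivable1_diffP.
by have := is_derive1_powR p x0 => -[].
Qed.

Lemma ge0_integral_powR G p : 0 < p ->
  (forall x, 0 < x -> {for x, continuous G}) -> (forall x, 0 < x -> 0 <= G x) ->
  (\int[mu]_(x in `]0%R, 1%R]) (G x)%:E =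
   \int[mu]_(x in `]0%R, 1%R]) (G (x `^ p) * (p * x `^ (p - 1)))%:E)%E.
Proof.
move=> p0 cG G0.
have pos x : `]0, 1]%classic x -> 0 < x by rewrite /= in_itv/= => /andP[].
have ndV m n : (m <= n)%N -> (n.+2%:R^-1 : R) <= m.+2%:R^-1.
  by move=> mn; rewrite lef_pV2 ?posrE// ler_nat; lia.
apply: (@ge0_integral_subst_increasing R (fun x => x `^ p)
  (fun x => p * x `^ (p - 1)) G (fun n => n.+2%:R^-1) (fun n => 1)) => //=.
- by move=> n; rewrite invf_lt1// ltr1n.
- by apply: bigcup_itvcc_01 => //; exact: natV_le_real.
- rewrite powR1; apply: bigcup_itvcc_01.
  + by move=> n; rewrite powR_gt0.
  + move=> e e0; have [n ne] := powR_natN_le p0 e0.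
    by exists n; rewrite -powR_inv1// -powRrM mulN1r.
- move=> x y /pos x0 /pos y0 xy.
  by rewrite gt0_ltr_powR ?nnegrE ?ltW.
- by move=> x /pos x0; exact: is_derive1_powR.
- move=> x /pos x0; apply: continuousM; first exact: cst_continuous.
  exact: continuous_powR_at.
- by move=> x /pos x0; rewrite mulr_ge0 ?powR_ge0// ltW.
- by move=> x /pos; exact: cG.
- by move=> x /pos; exact: G0.
Qed.

(** The map x -> x^(-p) is decreasing from [1, oo[ onto ]0, 1], which moves the singularity at 0 out
    to infinity. *)
Lemma ge0_integral_powRN G p : 0 < p ->
  (forall x, 0 < x -> {for x, continuous G}) -> (forall x, 0 < x -> 0 <= G x) ->
  (\int[mu]_(x in `]0%R, 1%R]) (G x)%:E =
   \int[mu]_(x in `[1%R, +oo[) (G (x `^ (- p)) * (p * x `^ (- p - 1)))%:E)%E.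
Proof.
move=> p0 cG G0.
have pos x : `]0, 1]%classic x -> 0 < x by rewrite /= in_itv/= => /andP[].
have pos1 x : `[1, +oo[%classic x -> 0 < x.
  by rewrite /= in_itv/= andbT; exact: lt_le_trans.
apply: (@ge0_integral_subst_decreasing R (fun x => x `^ (- p))
  (fun x => p * x `^ (- p - 1)) G (fun n => 1) (fun n => n.+2%:R)) => //=.
- by move=> n; rewrite ltr1n.
- by move=> m n mn; rewrite ler_nat; lia.
- by apply: bigcup_itvcc_1y => //; exact: nat_ge_real.
- rewrite powR1; apply: bigcup_itvcc_01.
  + by move=> n; rewrite powR_gt0.
  + by move=> e e0; exact: powR_natN_le.
- move=> x y /pos1 x0 /pos1 y0 xy.
  by rewrite !powRN ltf_pV2 ?posrE ?powR_gt0// gt0_ltr_powR ?nnegrE ?ltW.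
- move=> x /pos1 x0; rewrite -mulNr; exact: is_derive1_powR.
- move=> x /pos1 x0; apply: continuousM; first exact: cst_continuous.
  exact: continuous_powR_at.
- by move=> x /pos1 x0; rewrite mulr_ge0 ?powR_ge0// ltW.
- by move=> x /pos; exact: cG.
- by move=> x /pos; exact: G0.
Qed.

End power_substitutions.

(** * Integrals of powers, with and without a logarithm *)

Section power_integrals.
Context {R : realType}.
Let mu := @lebesgue_measure R.

Lemma cvg_powRN (c : R) : 0 < c -> x `^ (- c) @[x --> +oo] --> 0.
Proof.
move=> c0; apply/cvgrPdist_le => e e0; near=> x.
rewrite sub0r normrN ger0_norm ?powR_ge0//.
have x0 : 0 < x by near: x; exact: nbhs_pinfty_gt.
have -> : e = (e `^ (- c^-1)) `^ (- c).
  by rewrite -powRrM mulrNN mulVf ?gt_eqF// powRr1// ltW.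
rewrite [leLHS]powRN [leRHS]powRN lef_pV2 ?posrE ?powR_gt0//.
by rewrite ge0_ler_powR ?nnegrE ?powR_ge0 ?(ltW c0) ?(ltW x0).
Unshelve. all: end_near. Qed.

Lemma integral1y_powR (c : R) : 0 < c ->
  (\int[mu]_(x in `[1%R, +oo[) (x `^ (- c - 1))%:E = (c^-1)%:E)%E.
Proof.
move=> c0.
rewrite (@ge0_continuous_FTC2y _ _ (fun x => - c^-1 * x `^ (- c)) 1 0).
- by rewrite powR1 mulr1 EFinN oppeK add0e.
- by move=> x _; exact: powR_ge0.
- apply: continuous_in_subspaceT => x /set_mem/=; rewrite in_itv/= andbT => x1.
  by apply: continuous_powR_at; rewrite (lt_le_trans _ x1).
- rewrite -(mulr0 (- c^-1)); apply: cvgM; [exact: cvg_cst|exact: cvg_powRN].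
- move=> x x1; apply: derivableM => //.
  by apply: derivable_powR; rewrite in_itv/= andbT (lt_trans _ x1).
- apply: cvg_at_right_filter; apply: cvgM; first exact: cvg_cst.
  exact: continuous_powR_at.
- move=> x; rewrite in_itv/= andbT => x1; have x0 := lt_trans ltr01 x1.
  rewrite derive1E; have D := is_derive1_powR (- c) x0.
  rewrite derive_val /GRing.scale/=; field.
  by rewrite gt_eqF.
Qed.

(** This is ln y < y at y = x^e. *)
Lemma ln_le_powR (e x : R) : 0 < e -> 0 < x -> ln x <= e^-1 * x `^ e.
Proof.
move=> e0 x0; rewrite ler_pdivlMl// -ln_powR.
by rewrite ltW// ln_sublinear// powR_gt0.
Qed.

(** Integration by parts gives the antiderivative - x^(-c) ln x / c - x^(-c) / c^2, which vanishes
    at infinity and equals - 1 / c^2 at 1. *)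
Lemma integral1y_ln_powR (c : R) : 0 < c ->
  (\int[mu]_(x in `[1%R, +oo[) (ln x * x `^ (- c - 1))%:E = (c ^- 2)%:E)%E.
Proof.
move=> c0.
have lnx : ln x * x `^ (- c) @[x --> +oo] --> (0 : R).
  (* Half of the exponent absorbs the logarithm: ln x is at most (2/c) x^(c/2), and x^(-c/2) still
     tends to 0. *)
  have c20 : 0 < c / 2 by rewrite divr_gt0.
  have : (c / 2)^-1 * x `^ (- (c / 2)) @[x --> +oo] --> (0 : R).
    by rewrite -(mulr0 (c / 2)^-1); apply: cvgM; [exact: cvg_cst|exact: cvg_powRN].
  apply: (@squeeze_cvgr _ _ _ _ (cst 0)); last exact: cvg_cst.
  near=> x; have x1 : 1 <= x by near: x; exact: nbhs_pinfty_ge.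
  have x0 := lt_le_trans ltr01 x1.
  rewrite mulr_ge0 ?powR_ge0 ?ln_ge0//=.
  (* Respelling the exponent - c lets x^(-c) appear as a common factor of both sides; what remains
     is [ln_le_powR] at c/2. *)
  have -> : - c = c / 2 * - 1 + - (c / 2) * 1 by lra.
  have -> : x `^ (- (c / 2)) = x `^ (c / 2) * x `^ (c / 2 * - 1 + - (c / 2) * 1).
    by rewrite -powRD_gt0//; congr (_ `^ _); lra.
  by rewrite mulrA ler_wpM2r ?powR_ge0// ln_le_powR.
rewrite (@ge0_continuous_FTC2y _ _
  (fun x => - c^-1 * (ln x * x `^ (- c)) + - c ^- 2 * x `^ (- c)) 1 0).
- by rewrite powR1 ln1 mul0r mulr0 mulr1 add0r sub0r -EFinN opprK.
- by move=> x x1; rewrite mulr_ge0 ?powR_ge0 ?ln_ge0.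
- apply: continuous_in_subspaceT => x /set_mem/=; rewrite in_itv/= andbT => x1.
  have x0 := lt_le_trans ltr01 x1.
  by apply: continuousM; [exact: continuous_ln|exact: continuous_powR_at].
- rewrite (_ : 0 = - c^-1 * 0 + - c ^- 2 * 0); last by rewrite !mulr0 addr0.
  apply: cvgD; apply: cvgM; [exact: cvg_cst|exact: lnx|exact: cvg_cst|].
  exact: cvg_powRN.
- move=> x x1; have x0 := lt_trans ltr01 x1.
  have D := is_derive1_powR (- c) x0; have D' := is_derive1_ln x0.
  exact: ex_derive.
- apply: cvg_at_right_filter; apply: cvgD; apply: cvgM; first exact: cvg_cst.
    by apply: cvgM; [exact: continuous_ln|exact: continuous_powR_at].
  exact: cvg_cst.
  exact: continuous_powR_at.
- move=> x; rewrite in_itv/= andbT => x1; have x0 := lt_trans ltr01 x1.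
  rewrite derive1E.
  have D := is_derive1_powR (- c) x0; have D' := is_derive1_ln x0.
  rewrite derive_val /GRing.scale/=.
  have -> : x `^ (- c) = x `^ (- c - 1) * x.
    by rewrite -{3}(powRr1 (ltW x0)) -powRD_gt0//; congr (_ `^ _); lra.
  by field; rewrite !gt_eqF.
Unshelve. all: end_near. Qed.

Lemma integral01_powR (c : R) : 0 < c ->
  (\int[mu]_(x in `]0%R, 1%R]) (x `^ (c - 1))%:E = (c^-1)%:E)%E.
Proof.
move=> c0; rewrite (@ge0_integral_powRN _ _ 1)//.
- rewrite -integral1y_powR//; apply: eq_integral => x /set_mem/=.
  rewrite in_itv/= andbT => x1; have x0 := lt_le_trans ltr01 x1.
  by rewrite -powRrM mul1r -powRD_gt0//; congr (_ `^ _)%:E; lra.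
- by move=> x; exact: continuous_powR_at.
- by move=> x _; exact: powR_ge0.
Qed.

End power_integrals.

(** * Differentiating an exponential family under the integral sign *)

Section exponential_family.
Context {R : realType} d {Y : measurableType d} {mu : {measure set Y -> \bar R}}.
Context (B : set Y) (w g : Y -> R) (lo hi : R) (mB : measurable B)
  (mw : measurable_fun B w) (mg : measurable_fun B g)
  (w0 : forall y, B y -> 0 <= w y)
  (intw : forall s, lo < s < hi ->
    mu.-integrable B (fun y => (w y * expR (s * g y))%:E)).

(* From [e |x| <= exp (e |x|)]: the bound no longer depends on [s], so it
   dominates the derivative in [s] of [exp (s x)] around [s0]. *)
Lemma norm_mul_expR_le (x s s0 e : R) : 0 < e -> `|s - s0| <= e ->
  `|x| * expR (s * x) <=
  e^-1 * (expR ((s0 + 2 * e) * x) + expR ((s0 - 2 * e) * x)).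
Proof.
move=> e0 se.
have xe : `|x| <= e^-1 * expR (e * `|x|).
  rewrite ler_pdivlMl//; apply: le_trans (expR_ge1Dx _).
  by rewrite lerDr.
apply: (le_trans (ler_wpM2r (expR_ge0 _) xe)).
rewrite -mulrA ler_pM2l ?invr_gt0// -expRD.
(* The sign of [x] decides which of the two exponentials dominates; the other is only added. *)
have [x0|x0] := leP 0 x.
  rewrite ler_wpDr ?expR_ge0// ler_expR ger0_norm// -mulrDl ler_wpM2r//.
  by move: se; rewrite ler_norml => /andP[_]; lra.
rewrite ler_wpDl ?expR_ge0// ler_expR ltr0_norm// mulrN -mulNr -mulrDl.
rewrite ler_wnM2r// ?(ltW x0)//.
by move: se; rewrite ler_norml => /andP[+ _]; lra.
Qed.

(** Near [s0] the derivative of the integrand is dominated by a combination of the family's members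
    at s0 + 2e and s0 - 2e, which are integrable by assumption. Both Euler integrals have this form:
    gamma with [g] = ln t, beta with [g] = ln (1 + t). *)
Lemma is_derive_integral_expR (s0 : R) : lo < s0 < hi ->
  mu.-integrable B (fun y => (w y * g y * expR (s0 * g y))%:E) /\
  is_derive s0 1 (fun s => \int[mu]_(y in B) (w y * expR (s * g y)))
    (\int[mu]_(y in B) (w y * g y * expR (s0 * g y))).
Proof.
move=> /andP[los0 s0hi].
(* A third of the distance to the nearer end keeps s0 - 2e and s0 + 2e strictly inside the interval
   of integrability. *)
pose e : R := Num.min (s0 - lo) (hi - s0) / 3.
have e0 : 0 < e by rewrite divr_gt0// lt_min !subr_gt0 los0.
have elo : lo < s0 - 2 * e.
  have : e <= (s0 - lo) / 3 by rewrite ler_pM2r// ge_min lexx.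
  lra.
have ehi : s0 + 2 * e < hi.
  have : e <= (hi - s0) / 3 by rewrite ler_pM2r// ge_min lexx orbT.
  lra.
pose G y : R := `|w y| * (e^-1 * (expR ((s0 + 2 * e) * g y) + expR ((s0 - 2 * e) * g y))).
have G_ge0 y : 0 <= G y.
  by rewrite mulr_ge0// mulr_ge0 ?invr_ge0 ?(ltW e0)// addr_ge0 ?expR_ge0.
have intG : mu.-integrable B (EFin \o G).
  have i1 : mu.-integrable B (fun y => e^-1%:E *
      ((w y * expR ((s0 + 2 * e) * g y))%:E + (w y * expR ((s0 - 2 * e) * g y))%:E))%E.
    apply: integrableZl => //; apply: integrableD => //; apply: intw.
      by rewrite ehi andbT; lra.
    by rewrite elo/=; lra.
  apply: eq_integrable i1 => // y /set_mem By; rewrite /G /= -EFinD -EFinM.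
  by rewrite ger0_norm ?w0//; congr EFin; ring.
have bnd s y : `|s - s0| <= e -> B y -> `|w y * g y * expR (s * g y)| <= G y.
  move=> se By; rewrite !normrM (ger0_norm (expR_ge0 _)) -mulrA.
  by rewrite ler_wpM2l// norm_mul_expR_le.
have dexp (s : R) y : is_derive s 1 (fun s : R => w y * expR (s * g y))
    (w y * g y * expR (s * g y)).
  apply: is_derive_eq; rewrite /GRing.scale/=; ring.
have partialE s y :
    partial1of2 (fun s y => w y * expR (s * g y)) s y = w y * g y * expR (s * g y).
  by rewrite partial1of2E; apply: derive_val; exact: dexp.
have Is0 : `](s0 - e), (s0 + e)[%classic s0.
  by rewrite /= in_itv/=; apply/andP; split; lra.
have Ie s : `](s0 - e), (s0 + e)[%classic s -> `|s - s0| <= e.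
  by rewrite /= in_itv/= ler_norml => /andP[? ?]; apply/andP; split; lra.
have Ilh s : `](s0 - e), (s0 + e)[%classic s -> lo < s < hi.
  by rewrite /= in_itv/= => /andP[? ?]; apply/andP; split; lra.
split.
  apply: le_integrable intG => //.
    apply/measurable_EFinP; apply: measurable_funM; first exact: measurable_funM.
    by apply: measurableT_comp => //; apply: measurable_funM => //.
  move=> y By; rewrite lee_fin (ger0_norm (G_ge0 y)); apply: bnd => //.
  by rewrite subrr normr0 ltW.
have derf s y : `](s0 - e), (s0 + e)[%classic s -> B y ->
    derivable ((fun s y => w y * expR (s * g y)) ^~ y) s 1.
  by move=> _ _; have := dexp s y => -[].
have ub s y : `](s0 - e), (s0 + e)[%classic s -> B y ->
    `|partial1of2 (fun s y => w y * expR (s * g y)) s y| <= G y.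
  by move=> /Ie se By; rewrite partialE bnd.
have intf s : `](s0 - e), (s0 + e)[%classic s ->
    mu.-integrable B (EFin \o (fun y => w y * expR (s * g y))).
  by move=> /Ilh; exact: intw.
have der := derivable_under_integral mB Is0 intf derf G_ge0 intG ub.
apply: DeriveDef => //.
rewrite -derive1E (differentiation_under_integral mB Is0 intf derf G_ge0 intG ub).
by apply: eq_Rintegral => y _; exact: partialE.
Qed.

End exponential_family.

(** * The gamma function and the beta integral *)

Section positive_half_line.
Context {R : realType}.
Let mu := @lebesgue_measure R.

Lemma measurable_fun_pos (D : set R) (f : R -> R) : measurable D -> D `<=` `]0, +oo[ ->
  (forall x, 0 < x -> {for x, continuous f}) -> measurable_fun D f.
Proof.
move=> mD Dpos cf; apply: subspace_continuous_measurable_fun => //.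
apply: continuous_in_subspaceT => x /set_mem/Dpos/=; rewrite in_itv/= andbT.
exact: cf.
Qed.

Lemma subset_itv_0y_1y : `[1, +oo[ `<=` `]0 : R, +oo[.
Proof. by move=> x /=; rewrite !in_itv/= !andbT; exact: lt_le_trans. Qed.

Lemma subset_itv_0y_01 : `]0 : R, 1] `<=` `]0, +oo[.
Proof. by move=> x /=; rewrite !in_itv/= andbT => /andP[]. Qed.

Lemma ge0_integral_split1 (f : R -> R) :
  (forall x, 0 < x -> {for x, continuous f}) -> (forall x, 0 < x -> 0 <= f x) ->
  (\int[mu]_(x in `]0%R, +oo[) (f x)%:E =
   \int[mu]_(x in `]0%R, 1%R]) (f x)%:E + \int[mu]_(x in `[1%R, +oo[) (f x)%:E)%E.
Proof.
move=> cf f0.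
have split01 : `]0 : R, +oo[%classic = `]0, 1]%classic `|` `]1, +oo[%classic.
  apply/seteqP; split=> x /=; rewrite !in_itv/= !andbT.
    by move=> x0; have [x1|x1] := leP x 1; [left; rewrite x0|right].
  by move=> [/andP[]//|]; exact: lt_trans.
rewrite split01 ge0_integral_setU//=; last 3 first.
- apply/measurable_EFinP; apply: measurable_fun_pos => //; first exact: measurableU.
  by rewrite -split01.
- move=> x /=; rewrite !in_itv/= andbT lee_fin => -[/andP[x0 _]|/(lt_trans ltr01)]; exact: f0.
- rewrite disj_set2E; apply/eqP; rewrite -subset0 => x []/=; rewrite !in_itv/= andbT.
  by move=> /andP[_ x1]; rewrite ltNge x1.
(* The point 1 belongs to both pieces of the statement; it is null. *)
congr (_ + _)%E; apply: integral_itv_obnd_cbnd.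
apply/measurable_EFinP; apply: measurable_fun_pos => //.
by move=> x /=; rewrite !in_itv/= !andbT; exact: lt_trans.
Qed.

Lemma continuous_expRN : continuous (fun t : R => expR (- t)).
Proof.
move=> t; apply: (@continuous_comp _ _ _ -%R expR); last exact: continuous_expR.
exact: opp_continuous.
Qed.

End positive_half_line.

(** * Finiteness and positivity of gamma, the beta integral, the recurrence *)

Section gamma_basic.
Context {R : realType}.
Let mu := @lebesgue_measure R.
Implicit Types (x t a b s : R).

(** Take logarithms: ln (t / a) <= t / a multiplied by [a]. *)
Lemma powR_le_expR a t : 0 < a -> 0 < t -> t `^ a <= a `^ a * expR t.
Proof.
move=> a0 t0; rewrite /powR !gt_eqF// -expRD ler_expR.
have : ln (t / a) <= t / a by rewrite ltW// ln_sublinear// divr_gt0.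
rewrite ln_div// -(ler_pM2l a0) mulrBr mulrCA divff ?gt_eqF// mulr1.
by rewrite lerBlDl.
Qed.

Lemma continuous_powR1D (c t : R) : 0 < 1 + t -> 
  {for t, continuous (fun t : R => (1 + t) `^ c)}.
Proof.
move=> t0.
have H := is_derive1_powR c t0.
have H1 : is_derive t 1 (fun t : R => 1 + t) 1 by apply: is_derive_eq; rewrite add0r mulr1.
have [] := is_derive1_comp H H1.
by move=> /derivable1_diffP/differentiable_continuous.
Qed.

Lemma continuous_gamma_integrand x t : 0 < t ->
  {for t, continuous (fun t => t `^ (x - 1) * expR (- t))}.
Proof.
move=> t0; apply: continuousM; first exact: continuous_powR_at.
exact: continuous_expRN.
Qed.

Lemma gamma_integrand_ge0 x t : 0 <= t `^ (x - 1) * expR (- t).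
Proof. by rewrite mulr_ge0 ?powR_ge0 ?expR_ge0. Qed.

(** [gamma] is the real part of an extended integral, so the content is finiteness: the integrand is
    at most t^(x-1) on ]0, 1] and a multiple of t^(-2) on [1, oo[. *)
Lemma EFin_gamma x : 0 < x ->
  (\int[mu]_(t in `]0%R, +oo[) (t `^ (x - 1) * expR (- t))%:E = (gamma x)%:E)%E.
Proof.
move=> x0; rewrite /gamma /Rintegral fineK// ge0_fin_numE; last first.
  by apply: integral_ge0 => t _; rewrite lee_fin gamma_integrand_ge0.
rewrite ge0_integral_split1; last 2 first.
- by move=> t; exact: continuous_gamma_integrand.
- by move=> t _; exact: gamma_integrand_ge0.
apply: lte_add_pinfty.
  apply: (@le_lt_trans _ _ (\int[mu]_(t in `]0%R, 1%R]) (t `^ (x - 1))%:E)%E); last first.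
    by rewrite integral01_powR// ltry.
  apply: ge0_le_integral => //.
  - by move=> t _; rewrite lee_fin gamma_integrand_ge0.
  - apply/measurable_EFinP; apply: measurable_fun_pos => //; first exact: subset_itv_0y_01.
    by move=> t; exact: continuous_gamma_integrand.
  - apply/measurable_EFinP; apply: measurable_fun_pos => //; first exact: subset_itv_0y_01.
    by move=> t; exact: continuous_powR_at.
  - move=> t /=; rewrite in_itv/= => /andP[t0 _]; rewrite lee_fin.
    by rewrite ler_piMr ?powR_ge0// -expR0 ler_expR oppr_le0 ltW.
(* The constant of [powR_le_expR] at exponent x + 1, two above x - 1, which leaves the integrable
   t^(-2). *)
pose C := (x + 1) `^ (x + 1).
apply: (@le_lt_trans _ _ (\int[mu]_(t in `[1%R, +oo[) (C%:E * (t `^ (- 1 - 1))%:E))%E); last first.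
  rewrite ge0_integralZl//.
  - by rewrite integral1y_powR// -EFinM ltry.
  - apply/measurable_EFinP; apply: measurable_fun_pos => //; first exact: subset_itv_0y_1y.
    by move=> t; exact: continuous_powR_at.
  - by move=> t _; rewrite lee_fin powR_ge0.
  - by rewrite lee_fin powR_ge0.
apply: ge0_le_integral => //.
- by move=> t _; rewrite lee_fin gamma_integrand_ge0.
- apply/measurable_EFinP; apply: measurable_fun_pos => //; first exact: subset_itv_0y_1y.
  by move=> t; exact: continuous_gamma_integrand.
- apply/measurable_EFinP/measurable_funM => //.
  apply: measurable_fun_pos => //; first exact: subset_itv_0y_1y.
  by move=> t; exact: continuous_powR_at.
- move=> t /=; rewrite in_itv/= andbT => t1; have t0 := lt_le_trans ltr01 t1.
  rewrite -EFinM lee_fin.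
  have -> : x - 1 = (x + 1) + (- 1 - 1) by lra.
  rewrite powRD_gt0// mulrAC ler_wpM2r ?powR_ge0//.
  rewrite expRN ler_pdivrMr ?expR_gt0//; apply: powR_le_expR => //; lra.
Qed.

Lemma gamma_gt0 x : 0 < x -> 0 < gamma x.
Proof.
move=> x0; rewrite -lte_fin -EFin_gamma//.
(* A lower bound of the integrand on [1, 2]: there t^(x-1) >= 1/t >= 1/2 and exp(-t) >= exp(-2). *)
pose c : R := 2^-1 * expR (- 2).
have c0 : 0 < c by rewrite mulr_gt0 ?invr_gt0 ?expR_gt0.
apply: (@lt_le_trans _ _ (\int[mu]_(t in `[1%R, 2%R]) c%:E)%E).
  rewrite integral_cst//= lebesgue_measure_itv/= lte_fin ltr1n -EFinB -EFinM lte_fin.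
  by rewrite mulr_gt0//; lra.
apply: (@le_trans _ _ (\int[mu]_(t in `[1%R, 2%R]) (t `^ (x - 1) * expR (- t))%:E)%E).
  have sub : `[1, 2] `<=` `]0 : R, +oo[.
    by move=> t /=; rewrite !in_itv/= andbT => /andP[? _]; lra.
  apply: ge0_le_integral => //.
  - by move=> t _; rewrite lee_fin ltW.
  - apply/measurable_EFinP; apply: measurable_fun_pos => //.
    by move=> t; exact: continuous_gamma_integrand.
  - move=> t /=; rewrite in_itv/= => /andP[t1 t2]; rewrite lee_fin.
    have t0 : 0 < t by lra.
    rewrite ler_pM ?invr_ge0 ?expR_ge0//; last by rewrite ler_expR lerN2.
    apply: (@le_trans _ _ (t `^ (-1))).
      by rewrite powR_inv1 ?(ltW t0)// lef_pV2 ?posrE.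
    by apply: ler_powR => //; lra.
apply: ge0_subset_integral => //.
- apply/measurable_EFinP; apply: measurable_fun_pos => //.
  by move=> t; exact: continuous_gamma_integrand.
- by move=> t _; rewrite lee_fin gamma_integrand_ge0.
- by move=> t /=; rewrite !in_itv/= andbT => /andP[? _]; lra.
Qed.

Lemma gamma1 : gamma 1 = 1 :> R.
Proof.
apply: EFin_inj; rewrite -EFin_gamma// integral_itv_obnd_cbnd; last first.
  apply/measurable_EFinP; apply: measurable_fun_pos => // t; exact: continuous_gamma_integrand.
under eq_integral do rewrite subrr powRr0 mul1r.
rewrite (@ge0_continuous_FTC2y _ _ (fun t => - expR (- t)) 0 0).
- by rewrite oppr0 expR0 EFinN oppeK add0e.
- by move=> t _; exact: expR_ge0.
- by apply: continuous_subspaceT; exact: continuous_expRN.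
- by rewrite -oppr0; apply: cvgN; exact: cvgr_expR.
- by move=> t _; exact: ex_derive.
- by apply: cvg_at_right_filter; apply: cvgN; exact: continuous_expRN.
- move=> t _; rewrite derive1E derive_val /GRing.scale/=; ring.
Qed.

Lemma integral_mul_indic (D : set R) (f : R -> R) :
  (\int[mu]_x (f x * \1_D x)%:E = \int[mu]_(x in D) (f x)%:E)%E.
Proof.
rewrite [RHS]integral_mkcond; apply: eq_integral => x _.
by rewrite patchE indicE; case: ifP; rewrite ?mulr1 ?mulr0.
Qed.

Lemma EFin_gamma_scale x s : 0 < x -> 0 < s ->
  (\int[mu]_(t in `]0%R, +oo[) ((s * t) `^ (x - 1) * expR (- (s * t)) * s)%:E
   = (gamma x)%:E)%E.
Proof.
move=> x0 s0; rewrite -EFin_gamma// [RHS](ge0_integral_scale s0)//.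
- by move=> t; exact: continuous_gamma_integrand.
- by move=> t _; exact: gamma_integrand_ge0.
Qed.

(* Both iterated integrals of [s^(a+b-1) v^(a-1) exp(-s(1+v))] are gamma
   integrals after rescaling the inner variable. *)
Lemma integral_beta a b : 0 < a -> 0 < b ->
  (\int[mu]_(v in `]0%R, +oo[) (v `^ (a - 1) * (1 + v) `^ (- (a + b)))%:E
   = (gamma a * gamma b / gamma (a + b))%:E)%E.
Proof.
move=> a0 b0; have ab0 := addr_gt0 a0 b0.
pose D : set R := `]0, +oo[%classic.
pose k (s v : R) := s `^ (a + b - 1) * v `^ (a - 1) * expR (- (s * (1 + v))).
(* Tonelli is used on the whole plane, so the restriction to the positive quadrant is carried by
   indicators. *)
pose f (z : R * R) := (k z.1 z.2 * \1_D z.2 * \1_D z.1)%:E.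
have mD : measurable D by exact: measurable_itv.
have mf : measurable_fun setT f.
  have m1 : measurable_fun setT (\1_D : R -> R) by exact: measurable_indic.
  apply/measurable_EFinP; apply: measurable_funM; last first.
    exact: (measurableT_comp m1 measurable_fst).
  apply: measurable_funM; last exact: (measurableT_comp m1 measurable_snd).
  apply: measurable_funM.
    apply: measurable_funM.
      exact: (measurableT_comp (measurable_powR _) measurable_fst).
    exact: (measurableT_comp (measurable_powR _) measurable_snd).
  apply: measurableT_comp => //; apply: measurableT_comp => //.
  apply: measurable_funM => //; exact: measurable_funD.
have f0 z : (0 <= f z)%E.
  by rewrite lee_fin !mulr_ge0 ?powR_ge0 ?expR_ge0// indicE.
have scale_ge0 x s t : 0 < s -> 0 <= (s * t) `^ (x - 1) * expR (- (s * t)) * s.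
  by move=> s0; rewrite !mulr_ge0 ?powR_ge0 ?expR_ge0// ltW.
have mscale x s : 0 < s ->
    measurable_fun D (fun t => ((s * t) `^ (x - 1) * expR (- (s * t)) * s)%:E).
  move=> s0; apply/measurable_EFinP; apply: measurable_fun_pos => // t t0.
  apply: continuousM; last exact: cst_continuous.
  apply: (@continuous_comp _ _ _ ( *%R s) (fun t => t `^ (x - 1) * expR (- t))).
    exact: mulrl_continuous.
  by apply: continuous_gamma_integrand; rewrite mulr_gt0.
have Dpos s : D s -> 0 < s by rewrite /D/= in_itv/= andbT.
(* Rescaling t = s v gives gamma a and leaves the gamma integrand of [b] in [s]. *)
have inner_v s : (\int[mu]_v (k s v * \1_D v * \1_D s)%:E =
    (s `^ (b - 1) * expR (- s) * gamma a * \1_D s)%:E)%E.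
  rewrite indicE; have [/set_mem/Dpos s0|_] := boolP (s \in D); last first.
    by under eq_integral do rewrite mulr0; rewrite integral0 mulr0.
  under eq_integral do rewrite mulr1.
  rewrite mulr1 integral_mul_indic EFinM -(EFin_gamma_scale a0 s0).
  rewrite -ge0_integralZl//; last 3 first.
  - exact: mscale.
  - by move=> v _; rewrite lee_fin scale_ge0.
  - by rewrite lee_fin mulr_ge0 ?powR_ge0 ?expR_ge0.
  apply: eq_integral => v /set_mem/Dpos v0; rewrite -EFinM /k; congr EFin.
  have -> : a + b - 1 = (b - 1) + ((a - 1) + 1) by ring.
  rewrite (powRM _ (ltW s0) (ltW v0)) !(powRD_gt0 _ _ s0) (powRr1 (ltW s0)).
  have -> : - (s * (1 + v)) = - s + - (s * v) by ring.
  by rewrite expRD; ring.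
(* Rescaling t = (1 + v) s gives gamma (a + b) and leaves the beta integrand in [v]. *)
have inner_s v : (\int[mu]_s (k s v * \1_D v * \1_D s)%:E =
    (v `^ (a - 1) * (1 + v) `^ (- (a + b)) * gamma (a + b) * \1_D v)%:E)%E.
  rewrite integral_mul_indic indicE; have [/set_mem/Dpos v0|_] := boolP (v \in D); last first.
    by under eq_integral do rewrite mulr0; rewrite integral0 mulr0.
  have v10 : 0 < 1 + v by rewrite addr_gt0.
  under eq_integral do rewrite mulr1.
  rewrite mulr1 EFinM -(EFin_gamma_scale ab0 v10).
  rewrite -ge0_integralZl//; last 3 first.
  - exact: mscale.
  - by move=> s _; rewrite lee_fin scale_ge0.
  - by rewrite lee_fin mulr_ge0 ?powR_ge0.
  apply: eq_integral => s /set_mem/Dpos s0; rewrite -EFinM /k; congr EFin.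
  rewrite (powRM _ (ltW v10) (ltW s0)) [s * _]mulrC.
  have vE : (1 + v) `^ (- (a + b)) * (1 + v) `^ (a + b - 1) * (1 + v) = 1.
    rewrite -{3}(powRr1 (ltW v10)) -!powRD_gt0//.
    have -> : - (a + b) + (a + b - 1) + 1 = 0 by ring.
    by rewrite powRr0.
  rewrite -[LHS]mulr1 -[X in _ * X = _]vE; ring.
have := @fubini_tonelli _ _ _ _ R mu mu f mf f0.
rewrite /f/=.
under eq_integral do rewrite inner_v.
under [in X in _ = X -> _]eq_integral do rewrite inner_s.
rewrite !integral_mul_indic.
under eq_integral do rewrite EFinM.
under [in X in _ = X -> _]eq_integral do rewrite EFinM.
rewrite ge0_integralZr//; last 3 first.
- apply/measurable_EFinP; apply: measurable_fun_pos => // t.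
  exact: continuous_gamma_integrand.
- by move=> t _; rewrite lee_fin gamma_integrand_ge0.
- by rewrite lee_fin ltW// gamma_gt0.
rewrite ge0_integralZr//; last 3 first.
- apply/measurable_EFinP; apply: measurable_fun_pos => // t t0.
  apply: continuousM; first exact: continuous_powR_at.
  by apply: continuous_powR1D; rewrite addr_gt0.
- by move=> t _; rewrite lee_fin mulr_ge0 ?powR_ge0.
- by rewrite lee_fin ltW// gamma_gt0.
rewrite EFin_gamma// => E.
rewrite (mulrC (gamma a)) 2!EFinM E -muleA -EFinM.
by rewrite divff ?mule1// gt_eqF// gamma_gt0.
Qed.

(** The beta integral at a = 1 is elementary, equal to 1/x, and the beta formula makes it gamma x /
    gamma (1 + x). *)
Lemma gammaS x : 0 < x -> gamma (x + 1) = x * gamma x.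
Proof.
move=> x0; have := integral_beta ltr01 x0.
under eq_integral do rewrite subrr powRr0 mul1r.
rewrite integral_itv_obnd_cbnd; last first.
  apply/measurable_EFinP; apply: measurable_fun_pos => // t t0.
  by apply: continuous_powR1D; rewrite addr_gt0.
have dF t : 0 < 1 + t ->
    is_derive t 1 (fun t => - x^-1 * (1 + t) `^ (- x)) ((1 + t) `^ (- (1 + x))).
  move=> t0; have D := is_derive1_powR (- x) t0.
  have D1 : is_derive t 1 (fun t : R => 1 + t) 1.
    by apply: is_derive_eq; rewrite add0r mulr1.
  have D2 := is_derive1_comp D D1.
  have -> : - (1 + x) = - x - 1 by ring.
  apply: is_derive_eq; rewrite /GRing.scale/=.
  by field; rewrite gt_eqF.
rewrite (@ge0_continuous_FTC2y _ _ (fun t => - x^-1 * (1 + t) `^ (- x)) 0 0).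
- rewrite addr0 powR1 gamma1 mulr1 mul1r -EFinB sub0r opprK => -[E].
  have g1 : gamma (1 + x) != 0 by rewrite gt_eqF// gamma_gt0// addr_gt0.
  rewrite addrC -[in RHS](divfK g1 (gamma x)) -E mulrA divff ?mul1r//.
  by rewrite gt_eqF.
- by move=> t _; exact: powR_ge0.
- apply: continuous_in_subspaceT => t /set_mem/=; rewrite in_itv/= andbT => t0.
  by apply: continuous_powR1D; rewrite ltr_wpDr.
- rewrite -(mulr0 (- x^-1)); apply: cvgM; first exact: cvg_cst.
  have := cvg_powRN x0; apply: cvg_comp.
  exact: cvg_addrl.
- by move=> t t0; have t10 := addr_gt0 ltr01 t0; have := dF _ t10 => -[].
- apply: cvg_at_right_filter; apply: cvgM; first exact: cvg_cst.
  by apply: continuous_powR1D; rewrite addr0.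
- move=> t; rewrite in_itv/= andbT => t0; have t10 := addr_gt0 ltr01 t0.
  by rewrite derive1E; apply: derive_val; exact: dF.
Qed.

Lemma gamma_nat n : gamma n.+1%:R = n`!%:R :> R.
Proof.
elim: n => [|n IHn]; first exact: gamma1.
by rewrite -natr1 gammaS// IHn factS natrM.
Qed.

End gamma_basic.

(** * Digamma and trigamma *)

Section digamma.
Context {R : realType}.
Let mu := @lebesgue_measure R.
Implicit Types (a b x y : R).

(** Since t^(s-1) = exp (s ln t) / t, gamma is an exponential family with weight exp(-t) / t. *)
Lemma derivable_gamma x : 0 < x -> derivable (@gamma R) x 1.
Proof.
move=> x0; pose D : set R := `]0, +oo[%classic.
have Dpos s : D s -> 0 < s by rewrite /D/= in_itv/= andbT.
have mD : measurable D by exact: measurable_itv.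
pose w (t : R) := expR (- t) * t^-1.
have wE s t : D t -> w t * expR (s * ln t) = t `^ (s - 1) * expR (- t).
  move=> /Dpos t0; rewrite /w (_ : expR (s * ln t) = t `^ s); last first.
    by rewrite /powR gt_eqF.
  rewrite (_ : t `^ s = t * t `^ (s - 1)); last first.
    rewrite -{2}(powRr1 (ltW t0)) -powRD_gt0//; congr (_ `^ _); ring.
  by field; rewrite gt_eqF.
have mw : measurable_fun D w.
  apply: measurable_fun_pos => // t t0; apply: continuousM.
    exact: continuous_expRN.
  by apply: continuousV => //; rewrite gt_eqF.
have mln : measurable_fun D (@ln R) by exact: measurable_funTS.
have w0 t : D t -> 0 <= w t.
  by move=> /Dpos t0; rewrite mulr_ge0 ?expR_ge0// invr_ge0 ltW.
have intw s : 0 < s < x + 1 ->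
    mu.-integrable D (fun t => (w t * expR (s * ln t))%:E).
  move=> /andP[s0 _].
  have : mu.-integrable D (fun t => (t `^ (s - 1) * expR (- t))%:E).
    apply/integrableP; split.
      apply/measurable_EFinP; apply: measurable_fun_pos => // t.
      exact: continuous_gamma_integrand.
    under eq_integral do rewrite gee0_abs ?lee_fin ?gamma_integrand_ge0//.
    by rewrite EFin_gamma// ltry.
  by apply: eq_integrable => // t /set_mem Dt; rewrite wE.
have x01 : 0 < x < x + 1 by rewrite x0 ltrDl ltr01.
have [_ dg] := @is_derive_integral_expR R _ (measurableTypeR R) mu D w (@ln R)
  _ _ mD mw mln w0 intw x x01.
have <- : (fun s => \int[mu]_(t in D) (w t * expR (s * ln t))) = @gamma R.
  by apply/funext => s; apply: eq_Rintegral => t /set_mem; exact: wE.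
by case: dg.
Qed.

Lemma is_derive_gamma x : 0 < x -> is_derive x 1 (@gamma R) (gamma x * digamma x).
Proof.
move=> x0; apply: DeriveDef; first exact: derivable_gamma.
by rewrite /digamma derive1E mulrCA divff ?mulr1// gt_eqF// gamma_gt0.
Qed.

(** For fixed [a], the integral of v^(a-1) (1+v)^s is an exponential family in [s]. Its closed form
    [B s], valid for s < -a, is differentiated at s = -(a+b). *)
Lemma integral_ln_beta a b : 0 < a -> 0 < b ->
  (\int[mu]_(v in `]0%R, +oo[)
     (v `^ (a - 1) * ln (1 + v) * (1 + v) `^ (- (a + b)))%:E
   = (gamma a * gamma b / gamma (a + b) * (digamma (a + b) - digamma b))%:E)%E.
Proof.
move=> a0 b0; pose D : set R := `]0, +oo[%classic.
have Dpos s : D s -> 0 < s by rewrite /D/= in_itv/= andbT.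
have mD : measurable D by exact: measurable_itv.
pose w (t : R) := t `^ (a - 1); pose g (t : R) := ln (1 + t).
have gE s t : D t -> expR (s * g t) = (1 + t) `^ s.
  by move=> /Dpos t0; rewrite /powR gt_eqF// addr_gt0.
have mw : measurable_fun D w.
  by apply: measurable_fun_pos => // t; exact: continuous_powR_at.
have mg : measurable_fun D g.
  apply: measurable_funTS; apply: measurableT_comp => //.
  exact: measurable_funD.
have w0 t : D t -> 0 <= w t by rewrite powR_ge0.
pose B s := gamma a * (gamma (- s - a) / gamma (- s)).
have BE s : s < - a -> (\int[mu]_(t in D) (w t * expR (s * g t))%:E = (B s)%:E)%E.
  move=> sa; have sa0 : 0 < - s - a by lra.
  have -> : B s = gamma a * gamma (- s - a) / gamma (a + (- s - a)).
    by rewrite /B mulrA; congr (_ / gamma _); ring.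
  rewrite -integral_beta//; apply: eq_integral => t /set_mem Dt.
  by rewrite gE//; congr (_ * _ `^ _)%:E; ring.
(* Convergence requires s < -a; the lower end is just some value below -(a+b), to make the interval
   a neighbourhood. *)
have intw s : - (a + b) - 1 < s < - a ->
    mu.-integrable D (fun t => (w t * expR (s * g t))%:E).
  move=> /andP[_ sa]; apply/integrableP; split.
    apply/measurable_EFinP; apply: measurable_funM => //.
    by apply: measurableT_comp => //; exact: measurable_funM.
  under eq_integral do rewrite gee0_abs ?lee_fin ?mulr_ge0 ?expR_ge0 ?powR_ge0//.
  by rewrite BE// ltry.
have s01 : - (a + b) - 1 < - (a + b) < - a by apply/andP; split; lra.
have [int dF] := @is_derive_integral_expR R _ (measurableTypeR R) mu D w g
  _ _ mD mw mg w0 intw _ s01.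
transitivity (\int[mu]_(t in D) (w t * g t * expR (- (a + b) * g t))%:E)%E.
  by apply: eq_integral => t /set_mem Dt; rewrite gE.
rewrite -[LHS]fineK ?integrable_fin_num//; congr EFin.
transitivity ('D_1 B (- (a + b))).
  (* The integral and [B] are known to agree only for s < -a, which is a neighbourhood of -(a+b). *)
  rewrite -[LHS](@derive_val _ _ _ _ _ _ _ dF); apply: near_eq_derive.
  near=> s; rewrite /Rintegral BE//.
  near: s; apply: lt_nbhsl; lra.
have ab0 := addr_gt0 a0 b0.
have d1 : is_derive (- (a + b)) 1 (fun s => gamma (- s - a)) (- (gamma b * digamma b)).
  have bE : b = - - (a + b) - a by ring.
  have h1 : is_derive (- - (a + b) - a) 1 (@gamma R) (gamma b * digamma b).
    by rewrite -bE; exact: is_derive_gamma.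
  have h2 : is_derive (- (a + b)) 1 (fun s : R => - s - a) (-1).
    by apply: is_derive_eq; rewrite subr0.
  have := @is_derive1_comp R (@gamma R) (fun s => - s - a) _ _ _ h1 h2.
  by rewrite mulrN1.
have d2 : is_derive (- (a + b)) 1 (fun s => gamma (- s))
    (- (gamma (a + b) * digamma (a + b))).
  have h1 : is_derive (- - (a + b)) 1 (@gamma R) (gamma (a + b) * digamma (a + b)).
    by rewrite opprK; exact: is_derive_gamma.
  have h2 : is_derive (- (a + b)) 1 (fun s : R => - s) (-1).
    exact: is_deriveNid.
  have := @is_derive1_comp R (@gamma R) (fun s => - s) _ _ _ h1 h2.
  by rewrite mulrN1.
have g0 : gamma (- - (a + b)) != 0 by rewrite opprK gt_eqF// gamma_gt0.
have d3 := @is_deriveV R (fun s => gamma (- s)) _ _ _ g0 d2.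
rewrite derive_val /GRing.scale/= !opprK (_ : a + b - a = b); last by ring.
have gab0 : gamma (a + b) != 0 by rewrite gt_eqF// gamma_gt0.
move: (gamma (a + b)) gab0 (gamma a) (gamma b) (digamma (a + b)) (digamma b).
by move=> gab gab0 ga gb pab pb; field.
Unshelve. all: end_near. Qed.

Lemma digamma_le a b : 0 < a -> 0 < b -> digamma b <= digamma (a + b).
Proof.
move=> a0 b0.
have : (0 <= (gamma a * gamma b / gamma (a + b) *
              (digamma (a + b) - digamma b))%:E)%E.
  rewrite -integral_ln_beta//; apply: integral_ge0 => v /=; rewrite in_itv/= andbT => v0.
  by rewrite lee_fin !mulr_ge0 ?powR_ge0// ln_ge0// lerDl ltW.
rewrite lee_fin pmulr_rge0 ?subr_ge0// divr_gt0 ?mulr_gt0 ?gamma_gt0// addr_gt0//.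
Qed.

Lemma digamma_homo x y : 0 < x -> x <= y -> digamma x <= digamma y.
Proof.
move=> x0; rewrite le_eqVlt => /predU1P[->//|xy].
by rewrite -(subrK x y) digamma_le// subr_gt0.
Qed.

(** Logarithmic differentiation of [gammaS], which holds near [x] because positivity is an open
    condition. *)
Lemma digammaS x : 0 < x -> digamma (x + 1) = digamma x + x^-1.
Proof.
move=> x0; have x10 : 0 < x + 1 by rewrite addr_gt0.
have h1 := is_derive_gamma x10.
have h2 : is_derive x 1 (fun y : R => y + 1) 1.
  by apply: is_derive_eq; rewrite addr0.
have h3 := is_derive_gamma x0.
have : is_derive x 1 (fun y => y * gamma y) (gamma x + x * (gamma x * digamma x)).
  by apply: is_derive_eq; rewrite /GRing.scale/= mulr1 addrC.
have := @is_derive1_comp R (@gamma R) (fun y => y + 1) _ _ _ h1 h2; rewrite mulr1.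
have E : \forall y \near x, (@gamma R \o (fun y : R => y + 1)) y = y * gamma y.
  near=> y; rewrite /= gammaS//; near: y; exact: lt_nbhsr.
move=> /(near_eq_is_derive E) H1 H2.
have : gamma (x + 1) * digamma (x + 1) = gamma x + x * (gamma x * digamma x).
  by rewrite -[LHS](@derive_val _ _ _ _ _ _ _ H1) -[RHS](@derive_val _ _ _ _ _ _ _ H2).
have g0 : gamma x != 0 by rewrite gt_eqF// gamma_gt0.
have x_neq0 : x != 0 by rewrite gt_eqF.
rewrite gammaS// => H; apply: (mulfI (mulf_neq0 x_neq0 g0)); rewrite H.
by move: (gamma x) (digamma x) => gx px; field.
Unshelve. all: end_near. Qed.

Lemma digammaDn x n : 0 < x ->
  digamma (x + n%:R) = digamma x + \sum_(0 <= k < n) (x + k%:R)^-1.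
Proof.
move=> x0; elim: n => [|n IHn]; first by rewrite addr0 big_nil addr0.
by rewrite -natr1 addrA digammaS ?ltr_wpDr// IHn big_nat_recr//= addrA.
Qed.

(** For x <= y <= x + m, monotonicity and the recurrence squeeze the difference between 0 and m / (x
    + n). *)
Lemma digamma_diff_cvg0 x y : 0 < x -> 0 < y ->
  digamma (y + n%:R) - digamma (x + n%:R) @[n --> \oo] --> 0.
Proof.
wlog xy : x y / x <= y.
  move=> H x0 y0; have [xy|/ltW yx] := leP x y; first exact: H.
  rewrite -oppr0; under eq_fun do rewrite -opprB.
  by apply: cvgN; exact: H.
move=> x0 y0; pose m := Num.bound (y - x).
have ym : y <= x + m%:R.
  by rewrite -lerBlDl ltW// archi_boundP// subr_ge0.
apply: (@squeeze_cvgr _ _ _ _ (cst 0) (fun n => m%:R * (x + n%:R)^-1)); last 2 first.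
- exact: cvg_cst.
- rewrite -(mulr0 m%:R); apply: cvgM; first exact: cvg_cst.
  apply/gtr0_cvgV0; first by near=> n; rewrite ltr_wpDr.
  apply/cvgryPge => A; near=> n.
  rewrite (@le_trans _ _ n%:R)//; last by rewrite lerDr ltW.
  by near: n; exact: nbhs_infty_ger.
near=> n; rewrite subr_ge0 digamma_homo ?lerD2r ?ltr_wpDr//=.
have xn0 : 0 < x + n%:R by rewrite ltr_wpDr.
apply: (@le_trans _ _ (digamma (x + n%:R + m%:R) - digamma (x + n%:R))).
  by rewrite lerD2r digamma_homo ?ltr_wpDr// addrAC lerD2r.
rewrite digammaDn// addrC addKr.
apply: (@le_trans _ _ (\sum_(0 <= k < m) (x + n%:R)^-1)).
  apply: ler_sum => k _; rewrite lef_pV2 ?posrE ?lerDl//.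
  by rewrite ltr_wpDr.
by rewrite sumr_const_nat subn0 mulr_natl.
Unshelve. all: end_near. Qed.

(** After the first term, (x+m+1)^(-2) is at most 1/(x+m) - 1/(x+m+1), which telescopes. *)
Lemma is_cvg_series_inv_sqr x : 0 < x -> cvgn (series (fun k => (x + k%:R) ^- 2)).
Proof.
move=> x0; apply: nondecreasing_is_cvgn.
  apply: nondecreasing_series => k _ _; rewrite invr_ge0 exprn_ge0//.
  by rewrite addr_ge0// ltW.
exists (x ^- 2 + x^-1) => _ [n _ <-].
have xk k : 0 < x + k%:R by rewrite ltr_wpDr.
have H m : series (fun k => (x + k%:R) ^- 2) m.+1 <= x ^- 2 + x^-1 - (x + m%:R)^-1.
  elim: m => [|m IHm]; first by rewrite /series/= big_nat1 addr0 addrK.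
  rewrite seriesSr (le_trans (lerD IHm (lexx _)))//.
  have x1 := xk m; have x2 := xk m.+1.
  suff : (x + m.+1%:R) ^- 2 <= (x + m%:R)^-1 - (x + m.+1%:R)^-1 by lra.
  have -> : (x + m%:R)^-1 - (x + m.+1%:R)^-1 = (x + m%:R)^-1 * (x + m.+1%:R)^-1.
    have uv : x + m.+1%:R = x + m%:R + 1 by rewrite -addrA natr1.
    rewrite uv in x2 *; move: (x + m%:R) x1 x2 => u u0 u10.
    by field; rewrite !gt_eqF.
  rewrite expr2 invfM ler_wpM2r ?invr_ge0 ?(ltW x2)//.
  by rewrite lef_pV2 ?posrE// lerD2l ler_nat.
case: n => [|n]; first by rewrite /series/= big_nil addr_ge0// invr_ge0 ?exprn_ge0// ltW.
by rewrite (le_trans (H n))// lerBlDr lerDl invr_ge0 ltW.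
Qed.

(** A first-order expansion with quadratic error, avoiding termwise differentiation. With u = x+k
    and v = y+k, 1/u - 1/v - (v-u)/u^2 = -(v-u)^2 / (u^2 v), and y >= x/2 bounds 1/v by 2/x. *)
Lemma digamma_diff_le x y (T := limn (series (fun k => (x + k%:R) ^- 2))) :
  0 < x -> x / 2 <= y ->
  `|digamma y - digamma x - (y - x) * T| <= (y - x) ^+ 2 * (2 / x * T).
Proof.
move=> x0 xy; have y0 : 0 < y by lra.
have cT : series (fun k => (x + k%:R) ^- 2) @ \oo --> T by exact: is_cvg_series_inv_sqr.
have xk k : 0 < x + k%:R by rewrite ltr_wpDr.
have yk k : 0 < y + k%:R by rewrite ltr_wpDr.
(* The subtracted difference vanishes in the limit and turns [S n] into a finite sum by the
   recurrence. *)
pose S n := digamma y - digamma x - (digamma (y + n%:R) - digamma (x + n%:R))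
  - (y - x) * series (fun k => (x + k%:R) ^- 2) n.
have SE n : S n = - \sum_(0 <= k < n) (y - x) ^+ 2 * ((y + k%:R)^-1 * (x + k%:R) ^- 2).
  have e1 : digamma y - digamma x - (digamma (y + n%:R) - digamma (x + n%:R)) =
      \sum_(0 <= k < n) ((x + k%:R)^-1 - (y + k%:R)^-1).
    rewrite !digammaDn// sumrB; move: (digamma x) (digamma y) => px py; ring.
  rewrite /S e1 /series/= mulr_sumr -sumrB -[RHS]sumrN; apply: eq_bigr => k _.
  move: (xk k) (yk k) => xk0 yk0.
  rewrite (_ : y - x = (y + k%:R) - (x + k%:R)); last by ring.
  move: (x + k%:R) (y + k%:R) xk0 yk0 => u v u0 v0.
  by field; rewrite !gt_eqF.
have Sle n : `|S n| <= (y - x) ^+ 2 * (2 / x * T).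
  rewrite SE normrN ger0_norm; last first.
    apply: sumr_ge0 => k _.
    by rewrite mulr_ge0 ?sqr_ge0// mulr_ge0 ?invr_ge0 ?exprn_ge0 ?(ltW (xk k)) ?(ltW (yk k)).
  rewrite -mulr_sumr ler_wpM2l ?sqr_ge0//.
  apply: (@le_trans _ _ (2 / x * series (fun k => (x + k%:R) ^- 2) n)).
    rewrite /series/= mulr_sumr; apply: ler_sum => k _.
    rewrite ler_wpM2r ?invr_ge0 ?exprn_ge0 ?(ltW (xk k))//.
    rewrite -(invrK 2) -invfM lef_pV2 ?posrE ?mulr_gt0//.
    by rewrite mulrC (le_trans xy)// lerDl.
  rewrite ler_wpM2l ?divr_ge0 ?(ltW x0)//.
  apply: nondecreasing_cvgn_le; last exact: is_cvg_series_inv_sqr.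
  by apply: nondecreasing_series => k _ _; rewrite invr_ge0 exprn_ge0// ltW.
have cS : S n @[n --> \oo] --> digamma y - digamma x - 0 - (y - x) * T.
  apply: cvgB; first apply: cvgB; first exact: cvg_cst.
    exact: digamma_diff_cvg0.
  by apply: cvgM; first exact: cvg_cst.
rewrite -{1}(subr0 (digamma y - digamma x)).
apply: (ler_cvg_to (cvg_norm cS) (cvg_cst _)).
by near=> n; exact: Sle.
Unshelve. all: end_near. Qed.

Lemma cvg_series_trigamma x : 0 < x ->
  series (fun k => (x + k%:R) ^- 2) @ \oo --> trigamma x.
Proof.
move=> x0; set T := limn (series (fun k => (x + k%:R) ^- 2)).
suff -> : trigamma x = T by exact: is_cvg_series_inv_sqr.
have T0 : 0 <= T.
  apply: limr_ge; first exact: is_cvg_series_inv_sqr.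
  near=> n; apply: sumr_ge0 => k _.
  by rewrite invr_ge0 exprn_ge0// addr_ge0// ltW.
rewrite /trigamma /derive1; apply/cvg_lim => //; apply/cvgrPdist_le => e e0.
(* The added 1 makes the Lipschitz constant positive, so that e / c is a usable radius. *)
pose c : R := 2 / x * T + 1.
have c0 : 0 < c by rewrite ltr_wpDl// mulr_ge0// divr_ge0// ltW.
near=> h.
have h0 : h != 0 by near: h; exact: nbhs_dnbhs_neq.
have hx : `|h| <= x / 2 by near: h; apply: dnbhs0_le; rewrite divr_gt0.
have he : `|h| <= e / c by near: h; apply: dnbhs0_le; rewrite divr_gt0.
have xh : x / 2 <= h + x by move: hx; rewrite ler_norml => /andP[+ _]; lra.
have := digamma_diff_le x0 xh; rewrite -/T addrK => H.
have -> : T - h^-1 *: (digamma (h + x) - digamma x) =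
    - (h^-1 * (digamma (h + x) - digamma x - h * T)).
  by rewrite /GRing.scale/=; move: (digamma x) (digamma _) => px py; field.
rewrite normrN normrM normfV ler_pdivrMl ?normr_gt0//.
apply: (le_trans H); rewrite -[h ^+ 2]real_normK ?num_real// expr2 -[leLHS]mulrA.
rewrite ler_wpM2l// (@le_trans _ _ (`|h| * c))//.
  by rewrite ler_wpM2l// lerDl.
by rewrite -ler_pdivlMr.
Unshelve. all: end_near. Qed.

End digamma.

(** * The two integrals *)

Section eseries_real.
Context {R : realType}.
Implicit Types (f : R^nat) (l : R).

Lemma sum_EFin_series f n : (\sum_(0 <= k < n) (f k)%:E)%E = (series f n)%:E.
Proof. by rewrite /series/= sumEFin. Qed.

Lemma eseries_EFin f l : series f @ \oo --> l ->
  (\sum_(0 <= n <oo) (f n)%:E = l%:E)%E.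
Proof.
move=> fl; apply/cvg_lim => //; under eq_fun do rewrite sum_EFin_series.
by apply: cvg_EFin => //; exact: nearW.
Qed.

(** Turns a finite value of an extended sum into real convergence; this is how the convergence claim
    of the theorem is obtained. *)
Lemma cvg_series_eseries f l : (forall n, 0 <= f n) ->
  (\sum_(0 <= n <oo) (f n)%:E = l%:E)%E -> series f @ \oo --> l.
Proof.
move=> f0 fl; have : cvgn (fun n => \sum_(0 <= k < n) (f k)%:E)%E.
  by apply: is_cvg_nneseries => n _; rewrite lee_fin.
move=> /[!fl] H.
have : ((series f n)%:E @[n --> \oo] --> l%:E)%E.
  by move: H; under eq_fun do rewrite sum_EFin_series.
by move/fine_cvgP => [].
Qed.

Lemma eseries_geometric (c r : R) : 0 <= r < 1 ->
  (\sum_(0 <= n <oo) (c * r ^+ n)%:E = (c / (1 - r))%:E)%E.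
Proof.
move=> /andP[r0 r1]; apply: eseries_EFin; apply: cvg_geometric_series.
by rewrite ger0_norm.
Qed.

End eseries_real.

(** * Series for the integrals over ]0, oo[ and [1, oo[, and the reduction from [0, 1] *)

Section integral_evaluation.
Context {R : realType}.
Let mu := @lebesgue_measure R.
Implicit Types (a q t x : R).

Lemma continuous_ln1D t : 0 < t -> {for t, continuous (fun t : R => ln (1 + t))}.
Proof.
move=> t0; apply: (@continuous_comp _ _ _ (fun t : R => 1 + t) (@ln R)).
  by apply: continuousD; [exact: cst_continuous|exact: cvg_id].
by apply: continuous_ln; rewrite addr_gt0.
Qed.

Lemma ln1D_ge0 t : 0 < t -> 0 <= ln (1 + t).
Proof. by move=> t0; rewrite ln_ge0// lerDl ltW. Qed.

Lemma sqr1D_gt0 t : 0 < 1 + t ^+ 2.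
Proof. by rewrite ltr_pwDl// sqr_ge0. Qed.

Lemma continuous_powR_div a t : 0 < t ->
  {for t, continuous (fun t : R => t `^ (a - 1) / (1 + t ^+ 2))}.
Proof.
move=> t0; apply: continuousM; first exact: continuous_powR_at.
apply: continuousV; first by rewrite gt_eqF// sqr1D_gt0.
by apply: continuousD; [exact: cst_continuous|exact: exprn_continuous].
Qed.

Lemma powR_div_ge0 a t : 0 <= t `^ (a - 1) / (1 + t ^+ 2).
Proof. by rewrite divr_ge0 ?powR_ge0// ltW// sqr1D_gt0. Qed.

Lemma powR1DN t n : 0 < t -> (1 + t) `^ (- n%:R) = (1 + t) ^- n.
Proof. by move=> t0; rewrite powR_invn// addr_ge0// ltW. Qed.

(* [1 + t^2 = (1 + t)^2 (1 - r)] with [r = 2 t / (1 + t)^2 < 1]. *)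
Lemma eseries_beta_kernel a t : 0 < t ->
  (\sum_(0 <= n <oo) (2 ^+ n * (t `^ (n%:R + a - 1) * ln (1 + t) *
     (1 + t) `^ (- (2 * n%:R + 2))))%:E
   = (t `^ (a - 1) / (1 + t ^+ 2) * ln (1 + t))%:E)%E.
Proof.
move=> t0; pose r : R := 2 * t / (1 + t) ^+ 2.
have t10 : 0 < 1 + t by rewrite addr_gt0.
have r01 : 0 <= r < 1.
  rewrite divr_ge0 ?mulr_ge0 ?exprn_ge0 ?ltW//= ltr_pdivrMr ?exprn_gt0// mul1r.
  by have := sqr1D_gt0 t; rewrite sqrrD expr1n mul1r mulr2n; lra.
have := eseries_geometric (t `^ (a - 1) * ln (1 + t) / (1 + t) ^+ 2) r01.
have -> : t `^ (a - 1) * ln (1 + t) / (1 + t) ^+ 2 / (1 - r) =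
    t `^ (a - 1) / (1 + t ^+ 2) * ln (1 + t).
  have := sqr1D_gt0 t; rewrite /r => st.
  move: (t `^ (a - 1)) (ln (1 + t)) => u v; field.
  by rewrite !gt_eqF.
move=> <-; apply: eq_eseriesr => n _; congr EFin.
have -> : n%:R + a - 1 = n%:R + (a - 1) by ring.
rewrite (powRD_gt0 n%:R (a - 1) t0) powR_mulrn ?(ltW t0)//.
have -> : 2 * n%:R + 2 = (2 * n + 2)%:R :> R by rewrite natrD natrM.
rewrite powR1DN// addnC exprD exprM /r.
move: (t `^ (a - 1)) (ln (1 + t)) ((1 + t) ^+ 2) => u v s.
rewrite invfM !exprMn exprVn; ring.
Qed.

(** The kernel expansion is integrated term by term, by nonnegativity, each term being
    [integral_ln_beta] at n + a and n + 2 - a. Convergence of the series is then read off from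
    finiteness of the integral. *)
Lemma integral_0y_series a (v : R^nat :=
    fun n => 2 ^+ n * (gamma (n%:R + a) * gamma (n%:R + 2 - a) / gamma (2 * n%:R + 2) *
      (digamma (2 * n%:R + 2) - digamma (n%:R + 2 - a)))) : 0 < a < 2 ->
  cvgn (series v) /\
  (\int[mu]_(t in `]0%R, +oo[) (t `^ (a - 1) / (1 + t ^+ 2) * ln (1 + t))%:E
   = (limn (series v))%:E)%E.
Proof.
move=> /andP[a0 a2].
pose f (n : nat) (t : R) := t `^ (n%:R + a - 1) * ln (1 + t) *
     (1 + t) `^ (- (2 * n%:R + 2)).
have f_ge0 n t : 0 < t -> 0 <= f n t.
  by move=> t0; rewrite !mulr_ge0 ?powR_ge0// ln1D_ge0.
have cf n t : 0 < t -> {for t, continuous (f n)}.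
  move=> t0; apply: continuousM; last by apply: continuous_powR1D; rewrite addr_gt0.
  by apply: continuousM; [exact: continuous_powR_at|exact: continuous_ln1D].
have If n : (\int[mu]_(t in `]0%R, +oo[) (2 ^+ n * f n t)%:E = (v n)%:E)%E.
  under eq_integral do rewrite EFinM.
  rewrite ge0_integralZl//; last 2 first.
  - by apply/measurable_EFinP; apply: measurable_fun_pos => // t; exact: cf.
  - by move=> t /=; rewrite in_itv/= andbT lee_fin; exact: f_ge0.
  have na0 : 0 < n%:R + a by rewrite ltr_wpDl.
  have nb0 : 0 < n%:R + 2 - a by rewrite -addrA ltr_wpDl// subr_gt0.
  have E : n%:R + a + (n%:R + 2 - a) = 2 * n%:R + 2 by ring.
  by have := integral_ln_beta na0 nb0; rewrite E => ->.
have v0 n : 0 <= v n.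
  rewrite -lee_fin -If; apply: integral_ge0 => t /=; rewrite in_itv/= andbT => t0.
  by rewrite lee_fin mulr_ge0 ?f_ge0// exprn_ge0.
have KE : (\int[mu]_(t in `]0%R, +oo[) (t `^ (a - 1) / (1 + t ^+ 2) * ln (1 + t))%:E
    = \sum_(0 <= n <oo) (v n)%:E)%E.
  under eq_eseriesr do rewrite -If.
  rewrite -integral_nneseries//; last 2 first.
  - move=> n; apply/measurable_EFinP; apply: measurable_funM => //.
    by apply: measurable_fun_pos => // t; exact: cf.
  - move=> n t /=; rewrite in_itv/= andbT => t0.
    by rewrite lee_fin mulr_ge0 ?f_ge0// exprn_ge0.
  apply: eq_integral => t /set_mem/=; rewrite in_itv/= andbT => t0.
  by rewrite eseries_beta_kernel.
have Kfin : (\int[mu]_(t in `]0%R, +oo[) (t `^ (a - 1) / (1 + t ^+ 2) * ln (1 + t))%:E)%E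
    \is a fin_num.
  rewrite ge0_fin_numE; last first.
    apply: integral_ge0 => t /=; rewrite in_itv/= andbT => t0.
    by rewrite lee_fin mulr_ge0 ?powR_div_ge0// ln1D_ge0.
  (* Finiteness by comparison with twice the term n = 0: 1/(1+t^2) <= 2/(1+t)^2, that is, (1-t)^2 >=
     0. *)
  have := If 0; rewrite /f add0r mulr0 add0r => I0.
  apply: (@le_lt_trans _ _ (2%:E * (v 0)%:E)%E); last by rewrite -EFinM ltry.
  rewrite -I0 -ge0_integralZl//; last 2 first.
  - apply/measurable_EFinP; apply: measurable_funM => //.
    by have := @measurable_fun_pos R _ (f 0) _ _ (cf 0); rewrite /f add0r mulr0 add0r; exact.
  - move=> t /=; rewrite in_itv/= andbT => t0; rewrite lee_fin mulr_ge0//.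
    by rewrite !mulr_ge0 ?powR_ge0// ln1D_ge0.
  apply: ge0_le_integral => //.
  - move=> t /=; rewrite in_itv/= andbT => t0.
    by rewrite lee_fin mulr_ge0 ?powR_div_ge0// ln1D_ge0.
  - apply/measurable_EFinP; apply: measurable_fun_pos => // t t0.
    by apply: continuousM; [exact: continuous_powR_div|exact: continuous_ln1D].
  - apply: measurable_funeM; apply/measurable_EFinP; apply: measurable_funM => //.
    by have := @measurable_fun_pos R _ (f 0) _ _ (cf 0); rewrite /f add0r mulr0 add0r; exact.
  - move=> t /=; rewrite in_itv/= andbT => t0; rewrite -EFinM lee_fin expr0 mul1r.
    rewrite [leLHS]mulrAC [leRHS]mulrCA.
    rewrite ler_wpM2l ?mulr_ge0 ?powR_ge0 ?ln1D_ge0//.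
    rewrite powR1DN// -(invrK 2) -invfM lef_pV2 ?posrE ?sqr1D_gt0//; last first.
      by rewrite mulr_gt0 ?invr_gt0// exprn_gt0// addr_gt0.
    rewrite ler_pdivrMl// -subr_ge0 (_ : _ - _ = (1 - t) ^+ 2) ?sqr_ge0//.
    ring.
have cv : series v @ \oo --> fine (\int[mu]_(t in `]0%R, +oo[)
    (t `^ (a - 1) / (1 + t ^+ 2) * ln (1 + t))%:E)%E.
  by apply: cvg_series_eseries => //; rewrite fineK.
split; first by apply/cvg_ex; eexists; exact: cv.
by move/cvg_lim : cv => -> //; rewrite fineK.
Qed.

(** Consecutive terms of the alternating expansion in 1/t^2 are paired, 1/(1+t^2) = (t^(-2) -
    t^(-4)) / (1 - t^(-4)), giving nonnegative terms fit for termwise integration. *)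
Lemma eseries_ln_kernel a t : 1 <= t ->
  (\sum_(0 <= n <oo) (ln t * t `^ (- (4 * n%:R + 2 - a) - 1)
                      - ln t * t `^ (- (4 * n%:R + 4 - a) - 1))%:E
   = (t `^ (a - 1) / (1 + t ^+ 2) * ln t)%:E)%E.
Proof.
rewrite le_eqVlt => /predU1P[<-|t1].
  (* At t = 1 the geometric ratio is 1, but the logarithm kills every term. *)
  by rewrite ln1 mulr0; apply: eseries0 => n _ _; rewrite !mul0r subrr.
have t0 : 0 < t by apply: lt_trans t1.
have tn n : t `^ (- n%:R) = t ^- n by rewrite powR_invn// ltW.
have r01 : 0 <= t ^- 4 < 1.
  by rewrite invr_ge0 exprn_ge0 ?(ltW t0)//= invf_lt1 ?exprn_gt0// exprn_egt1.
have := eseries_geometric (ln t * t `^ (a - 1) * (t ^- 2 - t ^- 4)) r01.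
have -> : ln t * t `^ (a - 1) * (t ^- 2 - t ^- 4) / (1 - t ^- 4) =
    t `^ (a - 1) / (1 + t ^+ 2) * ln t.
  have t4 : t ^+ 4 - 1 != 0 by rewrite subr_eq0 gt_eqF// exprn_egt1.
  have := sqr1D_gt0 t; move: (t `^ (a - 1)) (ln t) => u v st; field.
  by rewrite t4 !gt_eqF.
move=> <-; apply: eq_eseriesr => n _; congr EFin.
have -> : - (4 * n%:R + 2 - a) - 1 = (a - 1) + (- 2%:R + - (4 * n)%:R).
  by rewrite natrM; ring.
have -> : - (4 * n%:R + 4 - a) - 1 = (a - 1) + (- 4%:R + - (4 * n)%:R).
  by rewrite natrM; ring.
rewrite !(powRD_gt0 _ _ t0) !tn exprM exprVn.
move: (t `^ (a - 1)) (ln t) ((t ^+ 4) ^- n) (t ^- 2) (t ^- 4) => u v w z y.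
ring.
Qed.

Lemma integral_1y_trigamma a : a < 2 ->
  (\int[mu]_(t in `[1%R, +oo[) (t `^ (a - 1) / (1 + t ^+ 2) * ln t)%:E
   = ((trigamma ((2 - a) / 4) - trigamma ((4 - a) / 4)) / 16)%:E)%E.
Proof.
move=> a2.
pose c1 n : R := 4 * n%:R + 2 - a; pose c2 n : R := 4 * n%:R + 4 - a.
have c10 n : 0 < c1 n by rewrite /c1 -addrA ltr_wpDl ?mulr_ge0// subr_gt0.
have c20 n : 0 < c2 n by rewrite (lt_trans (c10 n))// /c1 /c2; lra.
have c12 n : c1 n <= c2 n by rewrite /c1 /c2; lra.
pose g n (t : R) := ln t * t `^ (- c1 n - 1) - ln t * t `^ (- c2 n - 1).
have clnp c t : 0 < t -> {for t, continuous (fun t : R => ln t * t `^ c)}.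
  by move=> t0; apply: continuousM; [exact: continuous_ln|exact: continuous_powR_at].
have cg n t : 0 < t -> {for t, continuous (g n)}.
  by move=> t0; apply: continuousB; exact: clnp.
have pos1 t : `[1, +oo[%classic t -> 1 <= t by rewrite /= in_itv/= andbT.
have g0 n t : 1 <= t -> 0 <= g n t.
  move=> t1; rewrite subr_ge0 ler_wpM2l ?ln_ge0// ler_powR//.
  by rewrite lerD2r lerN2.
have m1y (f : R -> R) : (forall t, 0 < t -> {for t, continuous f}) ->
    measurable_fun (`[1, +oo[%classic : set R) (fun t => (f t)%:E).
  move=> cf; apply/measurable_EFinP; apply: measurable_fun_pos => //.
  exact: subset_itv_0y_1y.
have Ig n : (\int[mu]_(t in `[1%R, +oo[) (g n t)%:E = (c1 n ^- 2 - c2 n ^- 2)%:E)%E.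
  (* A difference is integrated by adding the subtrahend back, so only nonnegative integrals occur,
     and then cancelling its finite value. *)
  have : (\int[mu]_(t in `[1%R, +oo[) (g n t)%:E +
      \int[mu]_(t in `[1%R, +oo[) (ln t * t `^ (- c2 n - 1))%:E = (c1 n ^- 2)%:E)%E.
    rewrite -(integral1y_ln_powR (c10 n)) -ge0_integralD//.
    - by apply: eq_integral => t _; rewrite -EFinD subrK.
    - by move=> t /pos1; rewrite lee_fin; exact: g0.
    - by apply: m1y => t; exact: cg.
    - by move=> t /pos1 t1; rewrite lee_fin mulr_ge0 ?ln_ge0 ?powR_ge0.
    - by apply: m1y => t; exact: clnp.
  rewrite integral1y_ln_powR// => H.
  by rewrite EFinB -H addeK.
transitivity (\int[mu]_(t in `[1%R, +oo[) \sum_(0 <= n <oo) (g n t)%:E)%E.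
  by apply: eq_integral => t /set_mem/pos1 t1; rewrite eseries_ln_kernel.
rewrite integral_nneseries//; last 2 first.
- by move=> n; apply: m1y => t; exact: cg.
- by move=> n t /pos1; rewrite lee_fin; exact: g0.
under eq_eseriesr do rewrite Ig.
apply: eseries_EFin.
(* The 16 comes from 4n + c = 4 (c/4 + n), squared. *)
have cT (c : R) : 0 < c -> series (fun n => (4 * n%:R + c) ^- 2) @ \oo -->
    trigamma (c / 4) / 16.
  move=> c0; have c40 : 0 < c / 4 by rewrite divr_gt0.
  have -> : series (fun n => (4 * n%:R + c) ^- 2) =
      (fun n => series (fun k => (c / 4 + k%:R) ^- 2) n / 16).
    apply/funext => n; rewrite /series/= mulr_suml; apply: eq_bigr => k _.
    have k0 : 0 <= k%:R :> R by [].
    move: (k%:R : R) k0 => x x0; field.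
    by rewrite gt_eqF//; lra.
  apply: cvgM; last exact: cvg_cst.
  exact: cvg_series_trigamma.
rewrite mulrBl (_ : series _ = (fun n => series (fun n => (4 * n%:R + (2 - a)) ^- 2) n
    - series (fun n => (4 * n%:R + (4 - a)) ^- 2) n)).
  by apply: cvgB; apply: cT; rewrite subr_gt0// (lt_trans a2)// ltr_nat.
apply/funext => n; rewrite /series/= -sumrB; apply: eq_bigr => k _.
by rewrite /c1 /c2 !addrA.
Qed.

(** The summand 1 of the first factor is treated by x = t^a, the summand x^(2q-2) by x = t^(-a);
    both then have the same kernel, the latter with ln (1 + 1/t) = ln (1 + t) - ln t. *)
Lemma integral_01_substitution q (a := q^-1) : 0 < q ->
  (\int[mu]_(x in `[0%R, 1%R])
     ((x `^ (2 * q - 2) + 1) * ln (x `^ q + 1) / (x `^ (2 * q) + 1))%:E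
   = a%:E * (\int[mu]_(t in `]0%R, 1%R]) (t `^ (a - 1) / (1 + t ^+ 2) * ln (1 + t))%:E
     + \int[mu]_(t in `[1%R, +oo[)
         (t `^ (a - 1) / (1 + t ^+ 2) * (ln (1 + t) - ln t))%:E))%E.
Proof.
move=> q0; have a0 : 0 < a by rewrite invr_gt0.
have qa : q * a = 1 by rewrite /a divff// gt_eqF.
pose G2 x := ln (x `^ q + 1) / (x `^ (2 * q) + 1).
pose G1 x := x `^ (2 * q - 2) * G2 x.
have den0 x : 0 < x `^ (2 * q) + 1 by rewrite ltr_wpDl ?powR_ge0.
have cG2 x : 0 < x -> {for x, continuous G2}.
  move=> x0; apply: continuousM.
    apply: (@continuous_comp _ _ _ (fun x : R => x `^ q + 1) (@ln R)).
      by apply: continuousD; [exact: continuous_powR_at|exact: cst_continuous].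
    by apply: continuous_ln; rewrite ltr_wpDl ?powR_ge0.
  apply: continuousV; first by rewrite gt_eqF.
  by apply: continuousD; [exact: continuous_powR_at|exact: cst_continuous].
have cG1 x : 0 < x -> {for x, continuous G1}.
  by move=> x0; apply: continuousM; [exact: continuous_powR_at|exact: cG2].
have G20 x : 0 <= G2 x by rewrite divr_ge0 ?(ltW (den0 x))// ln_ge0// lerDr powR_ge0.
have G10 x : 0 <= G1 x by rewrite mulr_ge0 ?powR_ge0.
have pos x : `]0, 1]%classic x -> 0 < x by rewrite /= in_itv/= => /andP[].
have mpos (f : R -> R) : (forall t, 0 < t -> {for t, continuous f}) ->
    measurable_fun (`]0, 1]%classic : set R) (fun t => (f t)%:E).
  move=> cf; apply/measurable_EFinP; apply: measurable_fun_pos => //.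
  exact: subset_itv_0y_01.
have GE : (fun x => (x `^ (2 * q - 2) + 1) * ln (x `^ q + 1) / (x `^ (2 * q) + 1)) =
    (fun x => G1 x + G2 x).
  by apply/funext => x; rewrite /G1 /G2; ring.
(* The null point 0 is dropped, since continuity and both substitutions are available for x > 0
   only. *)
rewrite -integral_itv_obnd_cbnd; last first.
  by apply: mpos => x x0; rewrite GE; apply: continuousD; [exact: cG1|exact: cG2].
transitivity (\int[mu]_(x in `]0%R, 1%R]) (G1 x)%:E +
    \int[mu]_(x in `]0%R, 1%R]) (G2 x)%:E)%E.
  rewrite -ge0_integralD//; last 4 first.
  - by move=> x _; rewrite lee_fin.
  - exact: mpos.
  - by move=> x _; rewrite lee_fin.
  - exact: mpos.
  by apply: eq_integral => x _; rewrite -EFinD -[in RHS](congr1 (fun f => f x) GE).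
rewrite (ge0_integral_powRN a0)// (ge0_integral_powR a0)//.
rewrite addeC ge0_muleDr; last 2 first.
- apply: integral_ge0 => t /pos t0; rewrite lee_fin mulr_ge0 ?powR_div_ge0//.
  exact: ln1D_ge0.
- apply: integral_ge0 => t /=; rewrite in_itv/= andbT => t1.
  have t0 := lt_le_trans ltr01 t1.
  rewrite lee_fin mulr_ge0 ?powR_div_ge0// subr_ge0 ler_ln ?posrE ?addr_gt0//.
  by rewrite lerDr.
congr (_ + _)%E.
- rewrite -ge0_integralZl//; last 3 first.
  + apply: mpos => t t0.
    by apply: continuousM; [exact: continuous_powR_div|exact: continuous_ln1D].
  + move=> t /pos t0; rewrite lee_fin mulr_ge0 ?powR_div_ge0//; exact: ln1D_ge0.
  + by rewrite lee_fin ltW.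
  apply: eq_integral => t /set_mem/pos t0; rewrite -EFinM /G2; congr EFin.
  rewrite -!powRrM (mulrC a) qa powRr1 ?(ltW t0)//.
  have -> : a * (2 * q) = 2%:R by rewrite mulrCA (mulrC a) qa mulr1.
  rewrite powR_mulrn ?(ltW t0)//.
  move: (t `^ (a - 1)) => u; rewrite (addrC t) (addrC _ 1); ring.
- rewrite -ge0_integralZl//; last 3 first.
  + apply/measurable_EFinP; apply: measurable_fun_pos => //; first exact: subset_itv_0y_1y.
    move=> t t0; apply: continuousM; first exact: continuous_powR_div.
    by apply: continuousB; [exact: continuous_ln1D|exact: continuous_ln].
  + move=> t /=; rewrite in_itv/= andbT => t1; have t0 := lt_le_trans ltr01 t1.
    rewrite lee_fin mulr_ge0 ?powR_div_ge0// subr_ge0 ler_ln ?posrE ?addr_gt0//.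
    by rewrite lerDr.
  + by rewrite lee_fin ltW.
  apply: eq_integral => t /set_mem/=; rewrite in_itv/= andbT => t1.
  have t0 := lt_le_trans ltr01 t1.
  rewrite -EFinM /G1 /G2; congr EFin.
  rewrite -!powRrM.
  have -> : - a * q = - 1 by rewrite mulNr mulrC qa.
  have -> : - a * (2 * q) = - 2%:R by rewrite mulNr mulrCA (mulrC a) qa mulr1.
  have -> : - a * (2 * q - 2) = (a - 1) + (a - 1).
    by rewrite mulrBr mulNr mulrCA (mulrC a) qa; ring.
  have -> : - a - 1 = - (a - 1) + - 2%:R by ring.
  rewrite (powRD_gt0 (a - 1) (a - 1) t0) (powRD_gt0 (- (a - 1)) (- 2%:R) t0).
  rewrite powR_inv1 ?(ltW t0)// powR_invn ?(ltW t0)// powRN.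
  have -> : t^-1 + 1 = (1 + t) / t by field; rewrite gt_eqF.
  rewrite ln_div ?posrE ?addr_gt0//.
  have u0 := powR_gt0 (a - 1) t0; have st := sqr1D_gt0 t.
  move: (t `^ (a - 1)) u0 (ln (1 + t)) (ln t) => u u0 v w; field.
  by rewrite !gt_eqF// addrC.
Qed.

End integral_evaluation.

(** * Assembly of the identity *)

Theorem theorem2p8 (R : realType) (q : R) (hq : 1 / 2 < q) :
  let u : R^nat := fun n : nat =>
    2 ^+ n * gamma (n%:R + 2 - 1 / q) * gamma (n%:R + 1 / q)
      / ((2 * n + 1)`!)%:R
      * (digamma (n%:R + 2 - 1 / q) - digamma (2 * n%:R + 2)) in
  cvgn (series u) /\
  (\int[@lebesgue_measure R]_(x in `[0%R, 1%R])
     ((x `^ (2 * q - 2) + 1) * ln (x `^ q + 1) / (x `^ (2 * q) + 1))%:E)%E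
  = (1 / (16 * q) * (trigamma ((4 * q - 1) / (4 * q))
                     - trigamma ((2 * q - 1) / (4 * q)))
     - 1 / q * limn (series u))%:E.
Proof.
move=> u; have q0 : 0 < q by lra.
pose a := q^-1.
have a0 : 0 < a by rewrite invr_gt0.
(* The hypothesis q > 1/2 is exactly a < 2, the convergence condition for both integrals. *)
have a2 : a < 2 by rewrite -(invrK 2) ltf_pV2 ?posrE ?invr_gt0//; lra.
have a02 : 0 < a < 2 by rewrite a0.
have [cv K] := integral_0y_series a02; have L := integral_1y_trigamma a2.
set v := (v in series v) in cv K.
(* The digamma difference in [u] is opposite to the nonnegative one in [v], and (2n+1)! is gamma
   (2n+2). *)
have uE : series u = - series v.
  apply/funext => n; rewrite fctE /series/= -sumrN; apply: eq_bigr => k _.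
  rewrite /u /v div1r -/a.
  have -> : gamma (2 * k%:R + 2) = ((2 * k + 1)`!)%:R :> R.
    by rewrite -[RHS]gamma_nat -natrM -natrD addnS.
  set F := (_ `!)%:R; set x := digamma _; set y := digamma _.
  by move: (gamma _) (gamma _) => gx gy; ring.
split; first by rewrite uE; exact: is_cvgN.
rewrite uE limN// integral_01_substitution// -/a.
have pos1 (t : R) : `[1, +oo[%classic t -> 0 < t.
  by rewrite /= in_itv/= andbT; exact: lt_le_trans.
have m1y (f : R -> R) : (forall t, 0 < t -> {for t, continuous f}) ->
    measurable_fun (`[1, +oo[%classic : set R) (fun t => (f t)%:E).
  move=> cf; apply/measurable_EFinP; apply: measurable_fun_pos => //.
  exact: subset_itv_0y_1y.
move: K; rewrite ge0_integral_split1; last 2 first.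
- move=> t t0; apply: continuousM; first exact: continuous_powR_div.
  exact: continuous_ln1D.
- by move=> t t0; rewrite mulr_ge0 ?powR_div_ge0 ?ln1D_ge0.
set A1 := (X in (X + _)%E = _ -> _); set A2 := (X in (_ + X)%E = _ -> _) => K.
set A3 := (X in (_ * (_ + X))%E = _).
(* On [1, oo[, ln (1+t) is the sum of the nonnegative functions ln (1+t) - ln t and ln t. *)
have A2E : (A2 = A3 + ((trigamma ((2 - a) / 4) - trigamma ((4 - a) / 4)) / 16)%:E)%E.
  rewrite -L /A3 -ge0_integralD//.
  - apply: eq_integral => t _; rewrite -EFinD; congr EFin.
    by move: (t `^ (a - 1)) (ln (1 + t)) (ln t) => x y z; ring.
  - move=> t /pos1 t0; rewrite lee_fin mulr_ge0 ?powR_div_ge0//.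
    by rewrite subr_ge0 ler_ln ?posrE ?addr_gt0// lerDr.
  - apply: m1y => t t0; apply: continuousM; first exact: continuous_powR_div.
    by apply: continuousB; [exact: continuous_ln1D|exact: continuous_ln].
  - move=> t; rewrite /= in_itv/= andbT => t1.
    by rewrite lee_fin mulr_ge0 ?powR_div_ge0// ln_ge0.
  - apply: m1y => t t0; apply: continuousM; first exact: continuous_powR_div.
    exact: continuous_ln.
(* Only the trigamma value is cancelled, and it is a real number; the finiteness of [A1] and [A3]
   need not be checked separately. *)
have -> : (A1 + A3 = (limn (series v) -
    (trigamma ((2 - a) / 4) - trigamma ((4 - a) / 4)) / 16)%:E)%E.
  by rewrite EFinB -K A2E addeA addeK.
rewrite -EFinM; congr EFin.
have -> : (4 * q - 1) / (4 * q) = (4 - a) / 4 by rewrite /a; field; rewrite gt_eqF.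
have -> : (2 * q - 1) / (4 * q) = (2 - a) / 4 by rewrite /a; field; rewrite gt_eqF.
move: (trigamma _) (trigamma _) (limn _) => x y z.
by rewrite /a; field; rewrite gt_eqF.
Qed.
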